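(* Let $P\subset\mathbb{R}^d$ be a rational $d$-polytope with denominator $q$, let $h^*(P;z)$ be defined by $\mathrm{Ehr}(P;z)=\frac{h^*(P;z)}{(1-z^q)^{d+1}}$, let $s=\deg h^*(P;z)$, let $\ell=q(d+1)-s$, and let $\overline{h^*}(P;z)=(1+z+\cdots+z^{\ell-1})\,h^*(P;z)$. Then $\overline{h^*}(P;z)$ has a unique decomposition $$\overline{h^*}(P;z)=a(z)+z^\ell b(z),$$ where $a(z)$ and $b(z)$ are polynomials with integer coefficients satisfying $a(z)=z^{q(d+1)-1}a(1/z)$ and $b(z)=z^{q(d+1)-1-\ell}b(1/z)$. Moreover, the coefficients of $a(z)$ and $b(z)$ are nonnegative.
   Context: The denominator $q$ of $P$ is the least common multiple of all denominators of the vertex coordinates of $P$, and $\mathrm{Ehr}(P;z)=\sum_{t\ge0}|tP\cap\mathbb{Z}^d|z^t$. *)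

(* Defs.v *)
From mathcomp Require Import all_boot all_order all_algebra.
From mathcomp Require Import finmap.
From mathcomp Require Import boolp classical_sets cardinality reals.

Set Implicit Arguments.
Unset Strict Implicit.
Unset Printing Implicit Defensive.

Import Order.TTheory GRing.Theory Num.Theory.
Local Open Scope classical_set_scope.
Local Open Scope ring_scope.

Definition aff_hull (R : realType) (d : nat) (A : set 'rV[R]_d) :
    set 'rV[R]_d :=
  [set x | exists (n : nat) (p : 'I_n -> 'rV[R]_d) (c : 'I_n -> R),
     [/\ forall i, A (p i), \sum_i c i = 1 & x = \sum_i c i *: p i]].

Definition conv_hull (R : realType) (d : nat) (A : set 'rV[R]_d) :
    set 'rV[R]_d :=
  [set x | exists (n : nat) (p : 'I_n -> 'rV[R]_d) (c : 'I_n -> R),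
     [/\ forall i, A (p i), forall i, 0 <= c i, \sum_i c i = 1
       & x = \sum_i c i *: p i]].

Definition rational_polytope (R : realType) (d : nat) (P : set 'rV[R]_d) :=
  exists V : seq 'rV[rat]_d,
    P = conv_hull [set map_mx ratr v | v in [set` V]].

Definition full_dimensional (R : realType) (d : nat) (P : set 'rV[R]_d) :=
  aff_hull P = setT.

Definition dotv (R : realType) (d : nat) (u x : 'rV[R]_d) : R :=
  \sum_(i < d) u 0 i * x 0 i.

(* A face is the set of maximizers over P of a linear functional; a vertex is
   a face reduced to a point. *)
Definition face (R : realType) (d : nat) (P : set 'rV[R]_d) (u : 'rV[R]_d) :
    set 'rV[R]_d :=
  [set x | P x /\ forall y, P y -> dotv u y <= dotv u x].

Definition is_vertex (R : realType) (d : nat) (P : set 'rV[R]_d)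
    (v : 'rV[R]_d) :=
  exists u : 'rV[R]_d, face P u = [set v].

(* The vertices of a rational polytope are rational points and finitely many,
   so for such P nothing is lost by working in rat and taking fset_set. *)
Definition denominator (R : realType) (d : nat) (P : set 'rV[R]_d) : nat :=
  (\big[lcmn/1]_(v <- fset_set
      [set v : 'rV[rat]_d | is_vertex P (map_mx ratr v)])
    \big[lcmn/1]_(i < d) `|denq (v 0%R i)|)%N.

Definition dilate (R : realType) (d : nat) (t : nat) (P : set 'rV[R]_d) :
    set 'rV[R]_d :=
  [set t%:R *: x | x in P].

(* P is bounded, hence fset_set is applied to a finite set. *)
Definition ehr (R : realType) (d : nat) (P : set 'rV[R]_d) (t : nat) : nat :=
  #|` fset_set [set z : 'rV[int]_d | dilate t P (map_mx intr z)] |%fset.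

(* Ehr(P; z) = h(z) / (1 - z^q)^(d+1) as formal power series with q the
   denominator of P, i.e. the Cauchy product of (1 - z^q)^(d+1) with Ehr(P; z)
   is h, coefficient by coefficient. *)
Definition is_hstar (R : realType) (d : nat) (P : set 'rV[R]_d)
    (h : {poly int}) :=
  forall n : nat,
    \sum_(i < n.+1)
      ((1 - 'X^(denominator P)) ^+ d.+1 : {poly int})`_i * (ehr P (n - i))%:Z
    = h`_n.

(* p(z) = z^m p(1/z) as an identity of rational functions; the exponent m is
   an integer since it may be -1. *)
Definition self_reciprocal (m : int) (p : {poly int}) :=
  let z : {fraction {poly int}} := tofrac 'X in
  tofrac p = z ^ m * (map_poly (intr : int -> {fraction {poly int}}) p).[z^-1].

(* Main.v *)
(* Let C be the cone over P in R^(d+1), generated by the lattice vectors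
   g_v = (q v, q), v a vertex of P, and let x be a lattice point of least height k
   in the interior of C. Lift the g_v to generic heights and x to a very low one:
   the lower facets of the lifted cone triangulate C into simplicial cones, each
   spanned by x and d of the g_v, in which the x-coordinate of a point p is the
   largest l such that p - l x lies in C. Removing from each of them the facets
   through x that are visible from a generic direction u makes them disjoint.
   Hence the series
     A = (1 - z^q)^d Ehr(boundary of P),
     D = (1 - z^q)^d (Ehr(interior of P) - z^k Ehr(P))
   are the generating functions of the lattice points of half-open boxes, with
   x-coordinate in {0} and in ]0, 1[ respectively, so they are polynomials with
   nonnegative coefficients. The reflection of a box in its center exchanges u
   and -u, while A and D do not depend on u; thus A and D are palindromic.
   Adding up, (1 - z^k) h = (1 - z^q) (A + D), so that a = (1 + ... + z^(q-1)) A
   and z^k b = (1 + ... + z^(q-1)) D give the decomposition, once a comparison of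
   degrees has shown that k = q (d + 1) - deg h. *)
Require Import Defs.
From mathcomp Require Import all_boot all_order all_algebra.
From mathcomp Require Import finmap ring lra zify polyrcf.
From mathcomp Require Import boolp classical_sets cardinality reals.

Set Implicit Arguments.
Unset Strict Implicit.
Unset Printing Implicit Defensive.

Import Order.TTheory GRing.Theory Num.Theory.
Local Open Scope ring_scope.

(** * Cones and the Farkas lemma *)

Section Eventually.
Variable R : rcfType.

Definition eventually (Q : R -> Prop) := exists M, forall t, M <= t -> Q t.

Lemma eventually_witness (Q : R -> Prop) : eventually Q -> exists t, Q t.
Proof. by case=> M HM; exists M; apply: HM. Qed.

Lemma eventually_and (Q1 Q2 : R -> Prop) :
  eventually Q1 -> eventually Q2 -> eventually (fun t => Q1 t /\ Q2 t).
Proof.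
case=> M1 H1 [M2 H2]; exists (Num.max M1 M2) => t; rewrite ge_max => /andP[? ?].
by split; [apply: H1|apply: H2].
Qed.

Lemma eventually_imp (Q1 Q2 : R -> Prop) :
  (forall t, Q1 t -> Q2 t) -> eventually Q1 -> eventually Q2.
Proof. by move=> Q12 [M HM]; exists M => t /HM/Q12. Qed.

Lemma eventually_all (I : finType) (Q : I -> R -> Prop) :
  (forall i, eventually (Q i)) -> eventually (fun t => forall i, Q i t).
Proof.
move=> Qev.
suff: forall s : seq I, eventually (fun t => {in s, forall i, Q i t}).
  by move=> /(_ (enum I)); apply: eventually_imp => t Qt i; apply: Qt; rewrite mem_enum.
elim=> [|i s]; first by exists 0.
move/(eventually_and (Qev i)); apply: eventually_imp => t [Qi Qs] j.
by rewrite inE => /orP[/eqP->|/Qs].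
Qed.

Lemma eventually_sg_horner (p : {poly R}) :
  eventually (fun t => Num.sg p.[t] = Num.sg (lead_coef p)).
Proof.
have pos (r : {poly R}) : 0 < lead_coef r -> eventually (fun t => 0 < r.[t]).
  move=> r0; case: (poly_pinfty_gt_lc r0) => M HM.
  by exists M => t /HM; apply: lt_le_trans.
case: (ltrgt0P (lead_coef p)) => [p0|p0|/eqP].
- by apply: eventually_imp (pos _ p0) => t t0; rewrite !gtr0_sg.
- have /pos : 0 < lead_coef (- p) by rewrite lead_coefN oppr_gt0.
  by apply: eventually_imp => t; rewrite hornerN oppr_gt0 => t0; rewrite !ltr0_sg.
- by rewrite lead_coef_eq0 => /eqP ->; exists 0 => t _; rewrite horner0 lead_coef0.
Qed.

(** A lexicographic sign rule. It later reads off the coordinates of a point pushed first into the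
    interior of the cone and then, much less, in a generic direction. *)
Lemma eventually_sg_quadratic (a b c : R) :
  eventually (fun t => Num.sg (t ^+ 2 * a + t * b + c) =
    if a != 0 then Num.sg a else if b != 0 then Num.sg b else Num.sg c).
Proof.
have lc : lead_coef (Poly [:: c; b; a]) = if a != 0 then a else if b != 0 then b else c.
  case: (eqVneq a 0) => [->|a0]; last by rewrite lead_coefE (@PolyK _ 0).
  case: (eqVneq b 0) => [->|b0] /=; rewrite !cons_poly_def !(polyC0, mul0r, add0r) ?lead_coefC //.
  rewrite lead_coefDl ?lead_coefMX ?lead_coefC ?size_mulX ?polyC_eq0 // !size_polyC b0.
  by case: (c != 0).
have := eventually_sg_horner (Poly [:: c; b; a]); rewrite lc.
apply: eventually_imp => t; rewrite horner_Poly /= mul0r add0r.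
have -> : (a * t + b) * t + c = t ^+ 2 * a + t * b + c by ring.
by move=> ->; case: (a != 0); case: (b != 0).
Qed.

(* [c i = t ^ i] for [i != x] and [c x = - t ^ m], with [t] large. *)
Lemma generic_vector (m : nat) (x : 'I_m) (S : finType) (a : S -> 'rV[R]_m) :
  exists c : 'cV[R]_m, forall s, a s != 0 ->
    (a s *m c) 0 0 != 0 /\
    (a s 0 x != 0 -> Num.sg ((a s *m c) 0 0) = - Num.sg (a s 0 x)).
Proof.
pose r s : {poly R} := \sum_(i < m | i != x) a s 0 i *: 'X^i.
pose p s : {poly R} := (- a s 0 x) *: 'X^m + r s.
pose c (t : R) : 'cV[R]_m := \col_i if i == x then - t ^+ m else t ^+ i.
have pc t s : (p s).[t] = (a s *m c t) 0 0.
  rewrite /p /r hornerD horner_sum hornerZ hornerXn mxE [RHS](bigD1 x) //= /c mxE eqxx.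
  rewrite mulNr mulrN; congr (_ + _); apply: eq_bigr => i ix.
  by rewrite mxE (negbTE ix) hornerZ hornerXn.
have szr s : (size (r s) <= m)%N.
  apply: (leq_trans (size_sum _ _ _)); apply/bigmax_leqP => i _.
  by apply: (leq_trans (size_scale_leq _ _)); rewrite size_polyXn.
(* The [x]-entry sits at ['X^m], above all powers in [r s], so when nonzero it decides the sign. *)
have lp s : a s 0 x != 0 -> lead_coef (p s) = - a s 0 x.
  move=> a0; have sz : size (- a s 0 x *: 'X^m : {poly R}) = m.+1.
    by rewrite size_scale ?oppr_eq0 // size_polyXn.
  by rewrite lead_coefDl ?sz ?ltnS // lead_coefZ lead_coefXn mulr1.
have p0 s : a s != 0 -> p s != 0.
  move=> as0; have [ax0|ax0] := eqVneq (a s 0 x) 0; last first.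
    by rewrite -lead_coef_eq0 lp // oppr_eq0.
  case/rV0Pn: as0 => i ai0.
  have ix : i != x by apply: contraNneq ai0 => ->; rewrite ax0.
  apply: contra_neq ai0 => /(congr1 (fun q : {poly R} => q`_i)).
  rewrite coefD coefZ coefXn coef0 (ltn_eqF (ltn_ord i)) mulr0 add0r.
  rewrite coef_sum (bigD1 i) //= coefZ coefXn eqxx mulr1 big1 ?addr0 //.
  by move=> j /andP[_ ji]; rewrite coefZ coefXn eq_sym (negbTE ji : (j == i :> nat) = false) mulr0.
have := eventually_all (fun s => eventually_sg_horner (p s)).
case/eventually_witness => t Ht; exists (c t) => s as0; rewrite -pc; split.
  by rewrite -sgr_eq0 Ht sgr_eq0 lead_coef_eq0 p0.
by move=> ax0; rewrite Ht lp // sgrN.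
Qed.

End Eventually.

Section Cone.
Variable R : realFieldType.

Definition cone (m D : nat) (G : 'M[R]_(m, D)) (p : 'rV[R]_D) :=
  exists2 l : 'rV[R]_m, (forall i, 0 <= l 0 i) & p = l *m G.

Variables (m D : nat) (G : 'M[R]_(m, D)).

Lemma cone0 : cone G 0.
Proof. by exists 0; rewrite ?mul0mx // => i; rewrite mxE. Qed.

Lemma coneD p r : cone G p -> cone G r -> cone G (p + r).
Proof.
case=> l l0 -> [k k0 ->]; exists (l + k); last by rewrite mulmxDl.
by move=> i; rewrite mxE addr_ge0.
Qed.

Lemma coneZ a p : 0 <= a -> cone G p -> cone G (a *: p).
Proof.
move=> a0 [l l0 ->]; exists (a *: l); last by rewrite -scalemxAl.
by move=> i; rewrite mxE mulr_ge0.
Qed.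

Lemma cone_sum (I : finType) (P : pred I) (F : I -> 'rV[R]_D) :
  (forall i, P i -> cone G (F i)) -> cone G (\sum_(i | P i) F i).
Proof. by move=> HF; apply: big_ind => //; [exact: cone0|exact: coneD]. Qed.

Lemma cone_row i : cone G (row i G).
Proof.
exists (delta_mx 0 i); last by rewrite -rowE.
by move=> j; rewrite mxE ler0n.
Qed.

End Cone.

Lemma entry_mulmx_col (R : realFieldType) (m D : nat) (M : 'M[R]_(m, D))
  (z : 'cV[R]_D) i : (M *m z) i 0 = (row i M *m z) 0 0.
Proof. by rewrite -row_mul [RHS]mxE. Qed.

Lemma sub_cone (R : realFieldType) (m n D : nat) (G : 'M[R]_(m, D)) (H : 'M[R]_(n, D)) p :
  (forall i, cone H (row i G)) -> cone G p -> cone H p.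
Proof.
move=> GH [l l0 ->]; rewrite mulmx_sum_row; apply: cone_sum => i _.
exact: coneZ.
Qed.

(** Induction on the number of generators, the first one, [g], being split off. If a functional
    separating [p] from the others is negative on [g], everything is projected along [g] and the
    induction hypothesis is applied once more. *)
Lemma farkas (R : realFieldType) (m D : nat) (G : 'M[R]_(m, D)) (p : 'rV[R]_D) :
  ~ cone G p ->
  exists y : 'cV[R]_D, (forall i, 0 <= (G *m y) i 0) /\ (p *m y) 0 0 < 0.
Proof.
elim: m G p => [|m IH] G p Np.
  have [i pi0] : exists i, p 0 i != 0.
    apply/rV0Pn; apply/negP => /eqP p0; apply: Np; rewrite p0; exact: cone0.
  exists (- p^T); split; first by move=> i0; case: i0.
  rewrite mulmxN mxE oppr_lt0 mxE (bigD1 i) //= mxE ltr_pwDl //.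
    by rewrite -expr2 exprn_even_gt0.
  by apply: sumr_ge0 => j _; rewrite mxE -expr2 sqr_ge0.
pose g := row ord0 G; pose H := \matrix_i row (lift ord0 i) G.
have rowH i : row i H = row (lift ord0 i) G by rewrite rowK.
have HG q : cone H q -> cone G q.
  by apply: sub_cone => i; rewrite rowH; exact: cone_row.
have [|y [yH yp]] := IH H p; first by move/HG.

have [yg|yg] := leP 0 ((g *m y) 0 0).
  exists y; split => // i; rewrite entry_mulmx_col; case: (unliftP ord0 i) => [j ->|->] //.
  by rewrite -rowH -entry_mulmx_col.
(* project along [g] onto the kernel of [y] *)
pose pr (q : 'rV[R]_D) := q - ((q *m y) 0 0 / (g *m y) 0 0) *: g.
pose K := \matrix_i pr (row i H).
have GK q : cone K q -> cone G q.
  apply: sub_cone => i; rewrite rowK; apply: coneD; first by apply: HG; exact: cone_row.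
  rewrite -scaleNr; apply: coneZ; last exact: cone_row.
  by rewrite oppr_ge0 mulr_ge0_le0 ?invr_le0 ?(ltW yg) // -entry_mulmx_col yH.
(* The rows of [K] arise from those of [H] by adding nonnegative multiples of [g], and so does [p]
   from [pr p]; hence [pr p] in the cone over [K] would put [p] into the cone over [G]. *)
have : exists y : 'cV[R]_D, (forall i, 0 <= (K *m y) i 0) /\ (pr p *m y) 0 0 < 0.
  apply: (IH K) => /GK Kp; apply: Np.
  have -> : p = pr p + ((p *m y) 0 0 / (g *m y) 0 0) *: g by rewrite /pr subrK.
  apply: coneD => //; apply: coneZ; last exact: cone_row.
  by rewrite ltW // nmulr_rgt0 // invr_lt0.
(* This functional is [z] composed with [pr], so it vanishes on [g]. *)
case=> z [zK zp]; exists (z - ((g *m z) 0 0 / (g *m y) 0 0) *: y).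
have prE q : (pr q *m z) 0 0 = (q *m (z - ((g *m z) 0 0 / (g *m y) 0 0) *: y)) 0 0.
  rewrite /pr mulmxBl mulmxBr -scalemxAl -scalemxAr !mxE.
  by ring.
split; last by rewrite -prE.
move=> i; rewrite entry_mulmx_col; case: (unliftP ord0 i) => [j ->|->].
  by rewrite -rowH -prE -(rowK (fun i => pr (row i H))) -entry_mulmx_col.
rewrite -/g mulmxBr -scalemxAr !mxE.
have -> (a b : R) : b != 0 -> a - a / b * b = 0 by move=> b0; field.
  by [].
by have := ltr0_neq0 yg; rewrite !mxE.
Qed.

(** * Bases and lower facets *)

Section Bases.
Variables (R : realFieldType) (m D : nat) (G : 'M[R]_(m, D)).

(* The rows of [G] indexed by [B] form a basis, and [p *m phi] lists the
   coordinates of [p] in that basis, extended by [0] outside of [B]. *)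
Definition coordinate_matrix (B : {set 'I_m}) (phi : 'M[R]_(D, m)) :=
  [/\ phi *m G = 1%:M,
      forall i j, i \in B -> (G *m phi) i j = (i == j)%:R
    & forall i j, j \notin B -> phi i j = 0].

Definition is_basis B := `[< exists phi, coordinate_matrix B phi >].

(** The matrix is determined by [B], so the choice is harmless; when [B] is not a basis the value is
    the default [0]. *)
Definition coords B : 'M[R]_(D, m) := xget 0 [set phi | coordinate_matrix B phi]%classic.

Lemma coordsP B : is_basis B -> coordinate_matrix B (coords B).
Proof. by move=> /asboolP[phi Hphi]; rewrite /coords; case: xgetP => [? ->//|/(_ phi)]. Qed.

Lemma coordinate_matrix_unique B phi (p : 'rV[R]_D) (a : 'rV[R]_m) :
  coordinate_matrix B phi -> (forall i, i \notin B -> a 0 i = 0) ->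
  p = a *m G -> p *m phi = a.
Proof.
case=> _ H2 _ aB ->; rewrite -mulmxA; apply/rowP => j; rewrite mxE.
rewrite (bigD1 j) //= big1 ?addr0 => [|i ij].
  have [jB|jB] := boolP (j \in B); last by rewrite aB // mul0r.
  by rewrite H2 // eqxx mulr1.
have [iB|iB] := boolP (i \in B); last by rewrite aB // mul0r.
by rewrite H2 // (negbTE ij) mulr0.
Qed.

Lemma coordinates_off B phi (p : 'rV[R]_D) j :
  coordinate_matrix B phi -> j \notin B -> (p *m phi) 0 j = 0.
Proof. by case=> _ _ H jB; rewrite mxE big1 // => i _; rewrite H // mulr0. Qed.

Lemma coordinatesK B phi (p : 'rV[R]_D) : coordinate_matrix B phi -> p *m phi *m G = p.
Proof. by case=> H _ _; rewrite -mulmxA H mulmx1. Qed.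

Lemma coordinates_row B phi i : coordinate_matrix B phi -> i \in B ->
  row i G *m phi = delta_mx 0 i.
Proof.
move=> [_ H _] iB; rewrite -row_mul; apply/rowP => j; rewrite !mxE.
by have := H i j iB; rewrite mxE eqxx eq_sym => ->.
Qed.

Lemma coordinates_expand B phi (p : 'rV[R]_D) : coordinate_matrix B phi ->
  p = \sum_(i in B) (p *m phi) 0 i *: row i G.
Proof.
move=> H; rewrite -{1}(coordinatesK p H) mulmx_sum_row (bigID (mem B)) /=.
rewrite addrC big1 ?add0r // => i iB.
by rewrite (coordinates_off _ H) // scale0r.
Qed.

(** Two traces agree: the diagonal of [G *m phi] is the indicator of [B], and [phi *m G] is the
    identity of size [D]. *)
Lemma card_basis B phi : coordinate_matrix B phi -> #|B| = D.
Proof.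
case=> H1 H2 H3; apply/eqP; rewrite -(eqr_nat R).
have <- : \tr (G *m phi) = D%:R by rewrite mxtrace_mulC H1 mxtrace1.
rewrite -sum1_card natr_sum /mxtrace big_mkcond /=; apply/eqP; apply: eq_bigr => i _.
case: ifPn => iB; first by rewrite H2 // eqxx.
by rewrite mxE big1 // => j _; rewrite H3 // mulr0.
Qed.

(** The row [mu - delta_mx 0 j] is a linear dependency of the rows of [G]. Subtracting a multiple of
    it leaves the represented point unchanged, and the multiple is the one that clears the
    coordinate at [b]. *)
Lemma coordinate_matrix_pivot B phi j b :
  coordinate_matrix B phi -> j \notin B -> b \in B ->
  let mu := row j G *m phi in mu 0 b != 0 ->
  coordinate_matrix (j |: B :\ b)
    (phi - (mu 0 b)^-1 *: (col b phi *m (mu - delta_mx 0 j))).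
Proof.
move=> H jB bB mu mub; have [H1 H2 H3] := H.
have muE k : (G *m phi) j k = mu 0 k by rewrite /mu -row_mul [RHS]mxE.
split.
- rewrite mulmxBl H1 -scalemxAl -mulmxA mulmxBl (coordinatesK _ H) -rowE subrr.
  by rewrite mulmx0 scaler0 subr0.
- move=> i k; rewrite !inE => iB'.
  rewrite mulmxBr -scalemxAr mulmxA colE !mulmxA -colE.
  rewrite mxE [X in _ + X]mxE [X in _ - X]mxE [X in _ - _ * X]mxE big_ord1 [(col _ _) _ _]mxE.
  rewrite [(mu - _) _ _]mxE [(- _ : 'rV_m) _ _]mxE [(delta_mx _ _) _ _]mxE eqxx /=.
  case/orP: iB' => [/eqP->|/andP[ib iB]].
    by rewrite !muE mulrA mulVf // mul1r opprB addrC subrK eq_sym.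
  by rewrite !H2 // (negbTE ib) mul0r mulr0 subr0.
- move=> i k; rewrite !inE negb_or negb_and negbK => /andP[kj kB].
  rewrite mxE [X in _ + X]mxE [X in _ - X]mxE [X in _ - _ * X]mxE big_ord1.
  rewrite [(col _ _) _ _]mxE [(mu - _) _ _]mxE [(- _ : 'rV_m) _ _]mxE [(delta_mx _ _) _ _]mxE.
  rewrite eqxx (negbTE kj) /= oppr0 addr0.
  case/orP: kB => [/eqP->|kB]; first by field.
  by rewrite (coordinates_off _ H kB) (H3 i k kB) !mulr0 subrr.
Qed.

Definition independent (B : {set 'I_m}) := forall a : 'rV[R]_m,
  (forall i, i \notin B -> a 0 i = 0) -> a *m G = 0 -> a = 0.

Hypothesis fullG : row_full G.

(** A maximal independent set containing [S] spans; a pseudoinverse of [G] with the other rows set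
    to zero then gives the coordinates. *)
Lemma independent_basis S : independent S ->
  exists (B : {set 'I_m}) phi, S \subset B /\ coordinate_matrix B phi.
Proof.
move=> /asboolP indS.
have [B /maxsetP[/asboolP indB maxB] SB] :=
  maxset_exists (P := fun B : {set 'I_m} => `[<independent B>]) indS.
pose I : 'M[R]_m := diag_mx (\row_i (i \in B)%:R).
have IE n (M : 'M[R]_(m, n)) i j : (I *m M) i j = (i \in B)%:R * M i j.
  by rewrite mul_diag_mx !mxE.
have EI n (M : 'M[R]_(n, m)) i j : (M *m I) i j = M i j * (j \in B)%:R.
  by rewrite mul_mx_diag !mxE.
have sub : (G <= I *m G)%MS.
  apply/row_subP => j; have [jB|jB] := boolP (j \in B).
    have -> : row j G = row j (I *m G) by apply/rowP => k; rewrite [RHS]mxE IE jB mul1r mxE.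
    exact: row_sub.
  (* By maximality, adding [j] creates a dependency; its coefficient at [j] is nonzero, so row [j]
     can be solved for. *)
  have : ~ independent (j |: B).
    move=> /asboolP ind; have /setP/(_ j) := maxB _ ind (finset.subsetUr _ _).
    by rewrite !inE eqxx (negbTE jB).
  move/existsNP => [a /not_implyP[aB /not_implyP[aG /eqP a0]]].
  have aj : a 0 j != 0.
    apply: contraNneq a0 => aj; apply/eqP; apply: indB => // i iB.
    have [->//|ij] := eqVneq i j; apply: aB; by rewrite !inE negb_or ij.
  have -> : row j G = (delta_mx 0 j - (a 0 j)^-1 *: a) *m (I *m G).
    have aIE : (a - a 0 j *: delta_mx 0 j) *m I = a - a 0 j *: delta_mx 0 j.
      apply/rowP => i; rewrite EI; have [iB|iB] := boolP (i \in B); first by rewrite mulr1.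
      rewrite mulr0 !mxE eqxx /=; have [->|ij] := eqVneq i j; first by rewrite mulr1 subrr.
      by rewrite aB ?mulr0 ?subr0 // !inE negb_or ij.
    have -> : delta_mx 0 j - (a 0 j)^-1 *: a = - (a 0 j)^-1 *: (a - a 0 j *: delta_mx 0 j).
      by rewrite scalerBr scalerA mulNr mulVf // scaleN1r opprK scaleNr addrC.
    rewrite mulmxA -scalemxAl aIE -scalemxAl mulmxBl aG sub0r -scalemxAl -rowE.
    by rewrite scalerN scalerA mulNr mulVf // scaleN1r opprK.
  exact: submxMl.
have fullI : row_full (I *m G) by rewrite -sub1mx (submx_trans _ sub) // sub1mx.
exists B, (pinvmx (I *m G) *m I); split=> //.
have H1 : pinvmx (I *m G) *m I *m G = 1%:M by rewrite -mulmxA mulVpmx.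
split=> // [i j iB|i j jB]; last by rewrite EI (negbTE jB) mulr0.
suff e : row i G *m (pinvmx (I *m G) *m I) - delta_mx 0 i = 0.
  have := subr0_eq e; rewrite -row_mul => /rowP/(_ j).
  by rewrite [LHS]mxE => ->; rewrite mxE eqxx eq_sym.
apply: indB => [k kB|]; last by rewrite mulmxBl -mulmxA H1 mulmx1 -rowE subrr.
rewrite mxE mulmxA EI (negbTE kB) mulr0 add0r !mxE eqxx /=.
by rewrite (negbTE (contraNneq _ kB)) ?oppr0 // => ->.
Qed.

Variable eta : 'cV[R]_D.
Hypothesis etaG : forall i, 0 < (G *m eta) i 0.

(** Pairing the dependency with [eta], which is positive on every row, excludes that all
    coefficients are at most zero. *)
Lemma positive_dependency (a : 'rV[R]_m) : a *m G = 0 -> a != 0 -> exists i, 0 < a 0 i.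
Proof.
move=> aG a0; apply/existsP; apply: contraNT a0; rewrite negb_exists => /forallP a0.
have {}a0 i : a 0 i <= 0 by rewrite leNgt.
have : \sum_i (- (a 0 i * (G *m eta) i 0)) = 0.
  rewrite sumrN; have /rowP/(_ 0) : a *m (G *m eta) = 0 by rewrite mulmxA aG mul0mx.
  by rewrite mxE [X in _ = X]mxE => ->; rewrite oppr0.
move/psumr_eq0P => H; apply/eqP/rowP => i.
have /eqP := H (fun i _ => etrans (oppr_ge0 _) (mulr_le0_ge0 (a0 i) (ltW (etaG i)))) i isT.
by rewrite oppr_eq0 mulf_eq0 (gt_eqF (etaG i)) orbF mxE => /eqP.
Qed.

(** Induction on the size of the support: if the supporting rows are dependent, moving along a
    dependency makes a coefficient vanish while the others stay nonnegative. *)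
Lemma caratheodory (p : 'rV[R]_D) : cone G p ->
  exists B phi, coordinate_matrix B phi /\ forall i, 0 <= (p *m phi) 0 i.
Proof.
case=> l l0 ->.
have [n] := ubnP #|[set i | l 0 i != 0]|; elim: n l l0 => // n IH l l0 ln.
have [ind|] := pselect (independent [set i | l 0 i != 0]).
  have [B [phi [lB H]]] := independent_basis ind.
  exists B, phi; split=> // i; rewrite (@coordinate_matrix_unique B _ _ l) //.
  move=> j jB; apply/eqP; apply: contraNT jB => lj; apply: (fintype.subsetP lB).
  by rewrite inE.
move/existsNP => [a /not_implyP[al /not_implyP[aG /eqP a0]]].
have [i1 ai1] := positive_dependency aG a0.
(* Ratio test: the minimal ratio is the largest multiple of [a] that can be subtracted without
   creating a negative coefficient. *)
case: (@Order.TotalTheory.arg_minP _ _ _ i1 (fun i => 0 < a 0 i)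
  (fun i => l 0 i / a 0 i) ai1) => i0 ai0 i0min.
have lai0 : 0 <= l 0 i0 / a 0 i0 by rewrite divr_ge0 // ltW.
pose l' := l - (l 0 i0 / a 0 i0) *: a.
have l'E i : l' 0 i = l 0 i - l 0 i0 / a 0 i0 * a 0 i by rewrite !mxE.
have -> : l *m G = l' *m G by rewrite mulmxBl -scalemxAl aG scaler0 subr0.
apply: IH => [i|].
  rewrite l'E subr_ge0; have [ai|ai] := ltP 0 (a 0 i); first by rewrite -ler_pdivlMr // i0min.
  by apply: le_trans (l0 i); rewrite mulr_ge0_le0.
rewrite ltnS in ln; apply: leq_trans ln; apply: proper_card; apply/fintype.properP; split.
  apply/fintype.subsetP => i; rewrite !inE; apply: contraNneq => li.
  by rewrite l'E li (al i) ?mulr0 ?subr0 // inE li eqxx.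
exists i0; rewrite inE; last by rewrite l'E divfK ?subrr ?eqxx // gt_eqF.
apply: contraTneq ai0 => li0; by rewrite al ?ltxx // inE li0 eqxx.
Qed.

(* Dual feasibility: the heights [c] lift [G], and the lifted cone over [B] is
   a lower facet of the lifted cone over [G]. *)
Definition lower_facet (c : 'cV[R]_m) B :=
  is_basis B /\ forall j, j \notin B -> 0 < ((delta_mx 0 j - row j G *m coords B) *m c) 0 0.

(* Simplex method: a cheapest basis whose cone contains [p] is a lower facet,
   since otherwise a pivot step makes it cheaper. *)
Lemma lower_facet_exists (c : 'cV[R]_m) (p : 'rV[R]_D) :
  (forall B j, is_basis B -> j \notin B ->
     ((delta_mx 0 j - row j G *m coords B) *m c) 0 0 != 0) ->
  (forall B i, is_basis B -> i \in B -> (p *m coords B) 0 i != 0) ->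
  cone G p ->
  exists B, lower_facet c B /\ forall i, 0 <= (p *m coords B) 0 i.
Proof.
move=> cgen pgen /caratheodory[B0 [phi0 [H0 p0]]].
have coordsE B phi (r : 'rV_D) : coordinate_matrix B phi -> r *m coords B = r *m phi.
  move=> H; have HB : is_basis B by apply/asboolP; exists phi.
  apply: (coordinate_matrix_unique (coordsP HB)); last by rewrite (coordinatesK _ H).
  by move=> i; exact: coordinates_off.
pose feas B := is_basis B && [forall i, 0 <= (p *m coords B) 0 i].
have fB0 : feas B0.
  apply/andP; split; first by apply/asboolP; exists phi0.
  by apply/forallP => i; rewrite (coordsE _ _ _ H0).
case: (@Order.TotalTheory.arg_minP _ _ _ B0 feas (fun B => (p *m coords B *m c) 0 0) fB0).
move=> B /andP[bB /forallP pB] Bmin; exists B; split=> //; split=> // j jB.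
rewrite lt_neqAle eq_sym cgen //= leNgt; apply/negP => cj.
have H := coordsP bB.
set mu := row j G *m coords B in cj.
have [b1 mub1] : exists b, 0 < mu 0 b.
  have [||i] := @positive_dependency (mu - delta_mx 0 j).
  - by rewrite mulmxBl (coordinatesK _ H) -rowE subrr.
  - apply/rV0Pn; exists j; rewrite mxE (coordinates_off _ H) // !mxE.
    by rewrite !eqxx sub0r oppr_eq0 oner_eq0.
  - rewrite mxE [(- _ : 'rV_m) _ _]mxE [(delta_mx _ _) _ _]mxE eqxx /= => h.
    by exists i; apply: lt_le_trans h _; rewrite gerBl ler0n.
(* The leaving index [b] is picked by the ratio test, which keeps the coordinates of [p] nonnegative
   after the pivot. *)
case: (@Order.TotalTheory.arg_minP _ _ _ b1 (fun i => 0 < mu 0 i)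
   (fun i => (p *m coords B) 0 i / mu 0 i) mub1) => b mub bmin.
have bB' : b \in B by apply: contraTT mub => bB'; rewrite (coordinates_off _ H) // ltxx.
have H' := coordinate_matrix_pivot H jB bB' (lt0r_neq0 mub).
set B' := (_ |: _) in H'; set phi' := (_ - _) in H'.
set l := p *m coords B in pB bmin.
have l'E : p *m coords B' = l - (l 0 b / mu 0 b) *: (mu - delta_mx 0 j).
  rewrite (coordsE _ _ _ H') mulmxBr -scalemxAr mulmxA colE mulmxA -colE.
  rewrite [col b _]mx11_scalar mul_scalar_mx scalerA [col _ _ _ _]mxE.
  by rewrite [in LHS]mulrC.
have lb : 0 < l 0 b / mu 0 b by rewrite divr_gt0 // lt_neqAle eq_sym pgen //= pB.
have : feas B'.
  apply/andP; split; first by apply/asboolP; exists phi'.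
  apply/forallP => i; rewrite l'E.
  have -> : (l - (l 0 b / mu 0 b) *: (mu - delta_mx 0 j)) 0 i =
     l 0 i - l 0 b / mu 0 b * mu 0 i + l 0 b / mu 0 b * (j == i)%:R.
    by rewrite !mxE eqxx /= (eq_sym i) mulrBr opprB addrA addrAC.
  apply: addr_ge0; last by rewrite mulr_ge0 ?ler0n // ltW.
  rewrite subr_ge0; have [mui|mui] := ltP 0 (mu 0 i); first by rewrite -ler_pdivlMr // bmin.
  by apply: le_trans (pB i); rewrite mulr_ge0_le0 // ltW.
(* The cost changes by a positive ratio times the negative reduced cost at [j], against the
   minimality of [B]. *)
move/Bmin; rewrite l'E leNgt => /negP; apply.
have -> : ((l - (l 0 b / mu 0 b) *: (mu - delta_mx 0 j)) *m c) 0 0 =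
   (l *m c) 0 0 + l 0 b / mu 0 b * ((delta_mx 0 j - mu) *m c) 0 0.
  by rewrite -(opprB mu) mulNmx mulmxBl -scalemxAl !mxE mulrN.
by rewrite gtrDl pmulr_rlt0.
Qed.

(** Complementary slackness: each basis costs at most as much as the other, and equality of costs
    forces both inclusions. *)
Lemma lower_facet_unique (c : 'cV[R]_m) (p : 'rV[R]_D) B B' :
  lower_facet c B -> lower_facet c B' ->
  (forall i, i \in B -> 0 < (p *m coords B) 0 i) ->
  (forall i, i \in B' -> 0 < (p *m coords B') 0 i) -> B = B'.
Proof.
(* The cost difference is a sum of reduced costs relative to [A], zero on [A] and positive off it,
   weighted by the coordinates in [A'], which are positive on all of [A']. *)
have key A A' : lower_facet c A -> lower_facet c A' ->
    (forall i, i \in A' -> 0 < (p *m coords A') 0 i) ->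
    (p *m coords A *m c) 0 0 <= (p *m coords A' *m c) 0 0 ?= iff (A' \subset A).
  move=> [bA hA] [bA' hA'] pA'; have HA := coordsP bA; have HA' := coordsP bA'.
  set l' := p *m coords A'.
  have l'0 i : 0 <= l' 0 i.
    by have [/pA'/ltW//|iA] := boolP (i \in A'); rewrite (coordinates_off _ HA').
  have e : (l' *m c) 0 0 - (p *m coords A *m c) 0 0 =
     \sum_i l' 0 i * ((delta_mx 0 i - row i G *m coords A) *m c) 0 0.
    rewrite -[in X in _ - X](coordinatesK p HA') -/l'; move: l' {l'0} => k.
    rewrite -!mulmxA mxE [X in _ - X]mxE -sumrB.
    apply: eq_bigr => i _; rewrite mulmxBl -rowE -mulmxA -mulrBr; congr (_ * _).
    by rewrite entry_mulmx_col [RHS]mxE [(- _ : 'M_1) _ _]mxE [(row i c) _ _]mxE.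
  have f0 i : 0 <= l' 0 i * ((delta_mx 0 i - row i G *m coords A) *m c) 0 0.
    rewrite mulr_ge0 //; have [iA|iA] := boolP (i \in A); last exact: ltW (hA _ iA).
    by rewrite (coordinates_row HA iA) subrr mul0mx mxE.
  split; first by rewrite -subr_ge0 e sumr_ge0.
  rewrite eq_sym -subr_eq0 e psumr_eq0; last by move=> i _.
  apply/allP/fintype.subsetP => [H i iA'|AA i _].
    have /eqP := H i (mem_index_enum _); apply: contraPT => iA; apply/eqP.
    by rewrite mulf_neq0 // gt_eqF // ?pA' // hA.
  apply/implyP => _; have [iA'|iA'] := boolP (i \in A'); last first.
    by rewrite /l' (coordinates_off _ HA') // mul0r.
  by rewrite (coordinates_row HA (AA _ iA')) subrr mul0mx [X in _ * X]mxE mulr0.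
move=> fB fB' pB pB'; apply/eqP; rewrite finset.eqEsubset.
have k1 := key _ _ fB fB' pB'; have k2 := key _ _ fB' fB pB.
have /eqP e : (p *m coords B *m c) 0 0 == (p *m coords B' *m c) 0 0 by rewrite eq_le k1 k2.
by rewrite -k1.2 -k2.2 e eqxx.
Qed.

End Bases.

(** * Half-open triangulations *)

Section HalfOpen.
Variables (R : rcfType) (m D : nat) (G : 'M[R]_(m, D)).
Variable eta : 'cV[R]_D.
Hypothesis fullG : row_full G.
Hypothesis etaG : forall i, 0 < (G *m eta) i 0.

(** The algebraic interior; one step size per direction is enough since the cone is convex. *)
Definition cone_interior (p : 'rV[R]_D) :=
  forall y, exists2 e, 0 < e & cone G (p + e *: y).

Variable x : 'I_m.
Hypothesis intx : cone_interior (row x G).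

Local Notation lam B p i := ((p *m coords G B) 0 i).

Lemma cone_interior_sub (p : 'rV[R]_D) e :
  0 < e -> cone G (p - e *: row x G) -> cone_interior p.
Proof.
move=> e0 pe y; have [f f0 Hf] := intx y; exists (e * f); first exact: mulr_gt0.
have -> : p + (e * f) *: y = (p - e *: row x G) + e *: (row x G + f *: y).
  by rewrite scalerDr scalerA addrA subrK.
by apply: coneD => //; apply: coneZ => //; exact: ltW.
Qed.

(** [a] is the dependency expressing row [j] in the basis, and its pairing with [c] is a reduced
    cost. The sign condition says that the height of [x] is low enough to outweigh all others. *)
Definition good_heights (c : 'cV[R]_m) := forall B j, is_basis G B -> j \notin B ->
  let a := delta_mx 0 j - row j G *m coords G B in
  (a *m c) 0 0 != 0 /\ (a 0 x != 0 -> Num.sg ((a *m c) 0 0) = - Num.sg (a 0 x)).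

Lemma good_heights_exist : exists c, good_heights c.
Proof.
pose a (s : {set 'I_m} * 'I_m) := delta_mx 0 s.2 - row s.2 G *m coords G s.1.
have [c Hc] := generic_vector x a; exists c => B j bB jB /=.
apply: (Hc (B, j)); apply/rV0Pn; exists j.
rewrite mxE [(- _ : 'rV_m) _ _]mxE (coordinates_off _ (coordsP bB)) // mxE !eqxx.
by rewrite oppr0 addr0 oner_eq0.
Qed.

(** [u] lies on no hyperplane spanned by a basis with one element left out. *)
Definition generic (u : 'rV[R]_D) :=
  forall B i, is_basis G B -> i \in B -> lam B u i != 0.

Lemma genericN u : generic u -> generic (- u).
Proof. by move=> gu B i bB iB; rewrite mulNmx mxE oppr_eq0 gu. Qed.

Lemma generic_exists : exists u, generic u.
Proof.
(* [generic_vector] needs a distinguished index; in dimension zero there is none, but every basis is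
   empty. *)
have [D0|D0] := posnP D.
  exists 0 => B i bB iB; have cB := card_basis (coordsP bB).
  have /eqP : #|B| = 0%N by rewrite cB D0.
  by rewrite cards_eq0 => /eqP BE; rewrite BE inE in iB.
pose a (s : {set 'I_m} * 'I_m) := (col s.2 (coords G s.1))^T.
have [c Hc] := generic_vector (Ordinal D0) a; exists c^T => B i bB iB.
have a0 : a (B, i) != 0.
  apply/eqP => a0; have := coordinates_row (coordsP bB) iB.
  move/rowP/(_ i); rewrite !mxE !eqxx big1 => [/esym/eqP|k _]; first by rewrite oner_eq0.
  by have /rowP/(_ k) := a0; rewrite !mxE /= => ->; rewrite mulr0.
have [+ _] := Hc (B, i) a0; congr (_ != _).
by rewrite !mxE; apply: eq_bigr => k _; rewrite !mxE mulrC.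
Qed.

Variable c : 'cV[R]_m.
Hypothesis goodc : good_heights c.

(** Otherwise the reduced cost of [x] would be governed by its own very low height and be
    negative. *)
Lemma lower_facet_mem B : lower_facet G c B -> x \in B.
Proof.
move=> [bB fB]; apply: contraT => xB; have [_] := goodc bB xB.
have ax : (delta_mx 0 x - row x G *m coords G B) 0 x = 1.
  rewrite mxE [(- _ : 'rV_m) _ _]mxE (coordinates_off _ (coordsP bB)) // mxE !eqxx.
  by rewrite oppr0 addr0.
rewrite ax oner_eq0 => /(_ isT); rewrite gtr0_sg ?fB // sgr1 => h; exfalso; lra.
Qed.

(** By [good_heights], the reduced cost at [j] has the sign of the [x]-coordinate of row [j] when
    the latter is nonzero, and reduced costs off a lower facet are positive. *)
Lemma lower_facet_coord_ge0 B p : lower_facet G c B -> cone G p -> 0 <= lam B p x.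
Proof.
move=> fB [l l0 ->]; have [bB fB2] := fB; have xB := lower_facet_mem fB.
have gx j : 0 <= lam B (row j G) x.
  have [jB|jB] := boolP (j \in B).
    by rewrite (coordinates_row (coordsP bB)) // mxE ler0n.
  have [_] := goodc bB jB; rewrite gtr0_sg ?fB2 //.
  have -> : (delta_mx 0 j - row j G *m coords G B) 0 x = - lam B (row j G) x.
    rewrite mxE [(- _ : 'rV_m) _ _]mxE [X in X + _]mxE /= (_ : x == j = false) ?add0r //.
    by apply: contraNF jB => /eqP <-.
  rewrite oppr_eq0 sgrN opprK leNgt => H; apply/negP => a0.
  have := H (ltr0_neq0 a0); rewrite ltr0_sg // => h; exfalso; lra.
rewrite -mulmxA mxE; apply: sumr_ge0 => j _; rewrite mulr_ge0 //.
by have := gx j; rewrite -row_mul mxE.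
Qed.

(* The cone over [B], without those facets through [row x G] which are
   visible from infinity in direction [u]. *)
Definition half_open (u : 'rV[R]_D) (B : {set 'I_m}) (p : 'rV[R]_D) := forall i, i \in B ->
  0 <= lam B p i /\ (i != x -> lam B u i < 0 -> 0 < lam B p i).

(** Membership is decided at the point [ps], which up to scaling is close to [p]. The signs of its
    coordinates are those of [p], then of [row x G], then of [u], lexicographically, so
    half-openness at [p] amounts to positivity at [ps]; and a generic point lies in the cone over
    exactly one lower facet. *)
Lemma half_open_decomposition u p : generic u -> cone G p ->
  exists! B, lower_facet G c B /\ half_open u B p.
Proof.
move=> gu Cp.
have [e e0 Ce] := intx u.
(* For such [s] the vector [s *: row x G + u] is in the cone. *)
have ev : eventually (fun s : R => e^-1 <= s) by exists e^-1.
have := eventually_all (fun s : {set 'I_m} * 'I_m => eventually_sg_quadratic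
  (lam s.1 p s.2) (lam s.1 (row x G) s.2) (lam s.1 u s.2)).
move/(eventually_and ev)/eventually_witness => [s [es Hs]].
pose ps := s ^+ 2 *: p + s *: row x G + u.
have psE B i : lam B ps i = s ^+ 2 * lam B p i + s * lam B (row x G) i + lam B u i.
  by rewrite !mulmxDl -!scalemxAl !mxE.
have {}Hs B i := Hs (B, i); rewrite /= in Hs.
have Cps : cone G ps.
  have -> : ps = s ^+ 2 *: p + (e^-1 *: (row x G + e *: u) + (s - e^-1) *: row x G).
    rewrite /ps -addrA; congr (_ + _); rewrite scalerDr scalerA mulVf ?gt_eqF // scale1r.
    by rewrite scalerBl addrAC addrCA subrr addr0.
  apply: coneD; first by apply: coneZ => //; exact: sqr_ge0.
  apply: coneD; first by apply: coneZ => //; rewrite invr_ge0 ltW.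
  by apply: coneZ; [rewrite subr_ge0|exact: cone_row].
have psgen B i : is_basis G B -> i \in B -> lam B ps i != 0.
  move=> bB iB; rewrite -sgr_eq0 psE Hs; case: ifPn; first by rewrite sgr_eq0.
  by move=> _; case: ifPn; rewrite sgr_eq0 // gu.
have xcoord B i : is_basis G B -> x \in B -> lam B (row x G) i = (i == x)%:R.
  by move=> bB xB; rewrite (coordinates_row (coordsP bB)) // mxE.
have pos B i : lower_facet G c B -> half_open u B p -> i \in B -> 0 < lam B ps i.
  move=> fB hB iB; have [bB _] := fB; have xB := lower_facet_mem fB.
  have [l0 l1] := hB i iB; rewrite -sgr_cp0 psE Hs xcoord //.
  case: ifPn => [l0'|/negPn/eqP l0']; first by rewrite gtr0_sg // lt_neqAle eq_sym l0'.
  have [ix|ix] := eqVneq i x; first by rewrite oner_eq0 /= sgr1.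
  rewrite eqxx /= gtr0_sg //; rewrite lt_neqAle eq_sym gu //= leNgt; apply/negP.
  by move/(l1 ix); rewrite l0' ltxx.
have [B [fB pB]] := lower_facet_exists fullG etaG (fun B j bB jB => (goodc bB jB).1) psgen Cps.
exists B; split=> [|B' [fB' hB']].
  split=> // i iB; have [bB _] := fB; have xB := lower_facet_mem fB.
  have : 0 < lam B ps i by rewrite lt_neqAle eq_sym psgen //= pB.
  rewrite -sgr_cp0 psE Hs xcoord //.
  case: ifPn => [l0|/negPn/eqP -> H]; first by rewrite sgr_cp0 => l1; rewrite ltW.
  split=> // /negbTE ix; move: H; rewrite ix eqxx /= => /eqP H.
  by move=> u0; move: H; rewrite ltr0_sg // => h; exfalso; lra.
apply: (@lower_facet_unique _ _ _ G c ps) => // i iB; last exact: pos.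
by rewrite lt_neqAle eq_sym psgen ?pB //; case: fB.
Qed.

Lemma half_open_cone u B p : is_basis G B -> half_open u B p -> cone G p.
Proof.
move=> bB hB; rewrite (coordinates_expand p (coordsP bB)); apply: cone_sum => i iB.
by apply: coneZ; [case: (hB i iB)|exact: cone_row].
Qed.

(** Shifting by [row x G] changes only the [x]-coordinate. The right side mentions neither [B] nor
    [u], so conditions on the [x]-coordinate become intrinsic to the cone. *)
Lemma half_open_shift u B p a : lower_facet G c B -> half_open u B p ->
  (lam B p x >= a) = `[< cone G (p - a *: row x G) >].
Proof.
move=> fB hB; have [bB _] := fB; have xB := lower_facet_mem fB.
have lE i : lam B (p - a *: row x G) i = lam B p i - a * (i == x)%:R.
  rewrite mulmxBl -scalemxAl (coordinates_row (coordsP bB)) //.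
  by rewrite mxE [(- _ : 'rV_m) _ _]mxE [(_ *: _ : 'rV_m) _ _]mxE [(delta_mx _ _) _ _]mxE.
apply/idP/asboolP => [ale|/(lower_facet_coord_ge0 fB)]; last first.
  by rewrite lE eqxx mulr1 subr_ge0.
rewrite (coordinates_expand (p - _) (coordsP bB)); apply: cone_sum => i iB.
apply: coneZ; last exact: cone_row.
rewrite lE; have [->|ix] := eqVneq i x; first by rewrite mulr1 subr_ge0.
by rewrite mulr0 subr0; case: (hB i iB).
Qed.

Lemma half_open_interior u B p : lower_facet G c B -> half_open u B p ->
  (0 < lam B p x) = `[< cone_interior p >].
Proof.
move=> fB hB; apply/idP/asboolP => [l0|/(_ (- row x G))[e e0]].
  by apply: (cone_interior_sub l0); apply/asboolP; rewrite -(half_open_shift _ fB hB).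
rewrite scalerN => /asboolP; rewrite -(half_open_shift _ fB hB).
exact: lt_le_trans.
Qed.

End HalfOpen.

(** * Counting *)

Section Counting.
Local Open Scope classical_set_scope.
Variable T : choiceType.

Definition cnt (A : set T) : nat := #|` fset_set A|%fset.

Lemma cnt_indicator (S A : set T) : finite_set S -> A `<=` S ->
  cnt A = (\sum_(z <- fset_set S) `[< A z >])%N.
Proof.
move=> fS AS; have fA := sub_finite_set AS fS.
rewrite -[RHS]big_mkcond sum1_count -size_filter; apply: perm_size.
apply: uniq_perm; rewrite ?filter_uniq ?fset_uniq // => z.
rewrite mem_filter !in_fset_set //; apply/idP/andP.
  by rewrite inE => Az; split=> //; rewrite inE; exact: AS.
by case=> /asboolP Az _; rewrite inE.
Qed.

Lemma cnt_partition (I : finType) (P : pred I) (F : I -> set T) (S : set T) :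
  finite_set S -> (forall z, S z -> exists! i, P i /\ F i z) ->
  (forall i, P i -> F i `<=` S) -> cnt S = (\sum_(i | P i) cnt (F i))%N.
Proof.
move=> fS uS FS; rewrite (cnt_indicator fS) //.
rewrite [RHS](eq_bigr (fun i => \sum_(z <- fset_set S) `[< F i z >])%N); last first.
  by move=> i Pi; rewrite (cnt_indicator fS) //; exact: FS.
rewrite exchange_big /= [LHS]big_seq [RHS]big_seq; apply: eq_bigr => z.
rewrite in_fset_set // inE => Sz; have [i [[Pi Fi] ui]] := uS z Sz.
rewrite (bigD1 i) //= big1 => [|j /andP[Pj ji]].
  by rewrite (asboolT Sz) (asboolT Fi).
rewrite asboolF // => Fj; move: ji; rewrite (ui j) ?eqxx //.
Qed.

Lemma cnt_setID (A B : set T) : finite_set A ->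
  cnt A = (cnt (A `&` B) + cnt (A `\` B))%N.
Proof.
move=> fA; rewrite !(cnt_indicator fA) ?subIsetl ?subDsetl // -big_split /=.
apply: eq_bigr => z _; rewrite asbool_and asbool_and asbool_neg.
by case: `[< A z >]; case: `[< B z >].
Qed.

Lemma cnt_image (f : T -> T) (A : set T) : finite_set A -> injective f ->
  cnt (f @` A) = cnt A.
Proof. by move=> fA fI; rewrite /cnt fset_set_image // card_imfset. Qed.

Lemma cnt0 : cnt set0 = 0%N.
Proof. by rewrite /cnt fset_set0 cardfs0. Qed.

Lemma cnt1 x : cnt [set x] = 1%N.
Proof. by rewrite /cnt fset_set1 cardfs1. Qed.

End Counting.

Section BackwardDifference.
Variable q : nat.

(** On generating functions this is multiplication by [1 - z^q]. *)
Definition bdiff (f : nat -> int) (t : nat) : int :=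
  f t - (if (q <= t)%N then f (t - q)%N else 0).

Lemma bdiff_sum (I : finType) (P : pred I) (F : I -> nat -> int) :
  bdiff (fun t => \sum_(i | P i) F i t) = fun t => \sum_(i | P i) bdiff (F i) t.
Proof.
apply/funext => t; rewrite /bdiff; case: ifP => _; first by rewrite sumrB.
by rewrite subr0; apply: eq_bigr => i _; rewrite subr0.
Qed.

Lemma iter_bdiff_sum n (I : finType) (P : pred I) (F : I -> nat -> int) :
  iter n bdiff (fun t => \sum_(i | P i) F i t) =
  fun t => \sum_(i | P i) iter n bdiff (F i) t.
Proof. by elim: n => //= n ->; rewrite bdiff_sum. Qed.

End BackwardDifference.

Lemma finite_bounded_lattice (d M : nat) :
  finite_set [set z : 'rV[int]_d | forall j, `|z 0 j| <= M%:Z]%classic.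
Proof.
pose f (y : 'rV['I_M.*2.+1]_d) : 'rV[int]_d := \row_j ((y 0 j : nat)%:Z - M%:Z).
apply: (@sub_finite_set _ _ (f @` [set: 'rV['I_M.*2.+1]_d])%classic).
  move=> z zM; exists (\row_j inord (absz (z 0 j + M%:Z))) => //.
  apply/rowP => j; rewrite !mxE; have := zM j => {}zM.
  by rewrite inordK; lia.
by apply: finite_image; exact: finite_finset.
Qed.

(** * Lattice points in boxes *)

Section LatticePoint.
Variables (R : rcfType) (d : nat).

Definition lattice_pt (z : 'rV[int]_d) (t : nat) : 'rV[R]_(d + 1) :=
  row_mx (map_mx intr z) (t%:R)%:M.

Definition height_form : 'cV[R]_(d + 1) := col_mx 0 1%:M.

Lemma height_lattice_pt z t : (lattice_pt z t *m height_form) 0 0 = t%:R.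
Proof. by rewrite mul_row_col mulmx0 add0r mulmx1 mxE eqxx. Qed.

Lemma lattice_ptD z t z' t' :
  lattice_pt (z + z') (t + t') = lattice_pt z t + lattice_pt z' t'.
Proof. by rewrite /lattice_pt map_mxD natrD raddfD add_row_mx. Qed.

Lemma lattice_pt0 : lattice_pt 0 0 = 0.
Proof. by rewrite /lattice_pt map_mx0 raddf0 row_mx0. Qed.

Lemma lattice_pt_sum (I : finType) (P : pred I) (z : I -> 'rV[int]_d) (t : I -> nat) :
  lattice_pt (\sum_(i | P i) z i) (\sum_(i | P i) t i)%N = \sum_(i | P i) lattice_pt (z i) (t i).
Proof.
rewrite /index_enum; elim: (Finite.enum I) => [|i s IH]; first by rewrite !big_nil lattice_pt0.
by rewrite !big_cons; case: (P i) => //; rewrite lattice_ptD IH.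
Qed.

Lemma lattice_pt_inj z z' t t' : lattice_pt z t = lattice_pt z' t' -> z = z' /\ t = t'.
Proof.
move=> e; split; last first.
  have := congr1 (fun p => (p *m height_form) 0 0) e; rewrite !height_lattice_pt.
  by move/eqP; rewrite eqr_nat => /eqP.
have [e1 _] := eq_row_mx e; apply/rowP => j; move/rowP/(_ j): e1; rewrite !mxE.
by move/eqP; rewrite eqr_int => /eqP.
Qed.

End LatticePoint.

Section Boxes.
Variables (R : rcfType) (d m q k : nat) (gz : 'I_m -> 'rV[int]_d) (ht : 'I_m -> nat).
Variable x : 'I_m.
Hypotheses (q0 : (0 < q)%N) (k0 : (0 < k)%N).
Hypothesis htx : ht x = k.
Hypothesis htq : forall i, i != x -> ht i = q.

Local Notation pt := (@lattice_pt R d).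
Local Notation eta := (@height_form R d).

Definition lattice_gens : 'M[R]_(m, d + 1) := \matrix_i pt (gz i) (ht i).
Local Notation G := lattice_gens.
Local Notation lam B p i := ((p *m coords G B) 0 i).

Lemma row_lattice_gens i : row i G = pt (gz i) (ht i).
Proof. exact: rowK. Qed.

Lemma ht_gt0 i : (0 < ht i)%N.
Proof. by have [->|/htq->] := eqVneq i x; rewrite ?htx. Qed.

Lemma height_lattice_gens i : 0 < (G *m eta) i 0.
Proof. by rewrite entry_mulmx_col row_lattice_gens height_lattice_pt ltr0n ht_gt0. Qed.

(** Every generator has height at least [1], so at height [t] all coefficients are at most [t],
    which bounds the entries of [z]. *)
Lemma finite_lattice_cone t : finite_set [set z | cone G (pt z t)]%classic.
Proof.
pose M := (t * \sum_i \sum_j absz (gz i 0 j)%R)%N.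
apply: sub_finite_set (finite_bounded_lattice d M) => z [l l0 zl] j.
have lt i : l 0 i <= t%:R.
  have := height_lattice_pt R z t; rewrite zl -mulmxA mxE (bigD1 i) //= => <-.
  rewrite entry_mulmx_col row_lattice_gens height_lattice_pt.
  apply: ler_wpDr; last by rewrite ler_peMr // ler1n ht_gt0.
  by apply: sumr_ge0 => a _; rewrite mulr_ge0 // ltW // height_lattice_gens.
rewrite -(ler_int R) intr_norm.
have -> : (z 0 j)%:~R = \sum_i l 0 i * (gz i 0 j)%:~R :> R.
  have := congr1 (fun p : 'rV[R]_(d + 1) => p 0 (lshift 1 j)) zl; rewrite row_mxEl !mxE => ->.
  by apply: eq_bigr => i _; rewrite mxE row_mxEl mxE.
apply: (le_trans (ler_norm_sum _ _ _)).
rewrite -pmulrn natrM natr_sum mulr_sumr; apply: ler_sum => i _.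
rewrite normrM (ger0_norm (l0 i)); apply: ler_pM => //.
by rewrite -intr_norm -natr_absz ler_nat (bigD1 j) //= leq_addr.
Qed.

(** Excluding [half_open_ge0 u (l - 1)] from this condition leaves [[0, 1[] for [0 <= u] and []0,
    1]] for [u < 0]. *)
Definition half_open_ge0 (u l : R) := if u < 0 then 0 < l else 0 <= l.

Lemma half_open_ge0E u l : half_open_ge0 u l <-> 0 <= l /\ (u < 0 -> 0 < l).
Proof.
rewrite /half_open_ge0; case: ifP => u0; split=> [l0|[]] //; last by move=> _; apply.
by split=> //; exact: ltW.
Qed.

Lemma half_open_ge0_ge0 u l : half_open_ge0 u l -> 0 <= l.
Proof. by case/half_open_ge0E. Qed.

(** The map from [l] to [1 - l] exchanges the two kinds of half-open unit interval. *)
Lemma half_open_ge0_reflect u l : u != 0 ->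
  half_open_ge0 (- u) (1 - l) = ~~ half_open_ge0 u (l - 1).
Proof.
move=> u0; rewrite /half_open_ge0 oppr_lt0 subr_gt0 !subr_ge0 subr_gt0.
by case: ltrgt0P u0 => // _ _; rewrite -?ltNge -?leNgt.
Qed.

Variable B : {set 'I_m}.
Hypotheses (basisB : is_basis G B) (xB : x \in B).

Lemma lamD (p r : 'rV[R]_(d + 1)) i : lam B (p + r) i = lam B p i + lam B r i.
Proof. by rewrite mulmxDl mxE. Qed.

Lemma lam_gen i j : i \in B -> lam B (pt (gz i) (ht i)) j = (j == i)%:R.
Proof.
move=> iB; rewrite -row_lattice_gens (coordinates_row (coordsP basisB)) // mxE.
by rewrite eqxx.
Qed.

Lemma height_coords z t : t%:R = \sum_(i in B) lam B (pt z t) i * (ht i)%:R.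
Proof.
rewrite -(height_lattice_pt R z t) {1}(coordinates_expand (pt z t) (coordsP basisB)).
rewrite mulmx_suml summxE; apply: eq_bigr => i _.
by rewrite -scalemxAl mxE row_lattice_gens height_lattice_pt.
Qed.

(* Lattice points at height [t] of a half-open cone over [B] whose
   [x]-coordinate satisfies [X], with the coordinates in [J] cut off at [1]. *)
Definition slice (u : 'rV[R]_(d + 1)) (X : R -> bool) (J : {set 'I_m}) t : set 'rV[int]_d :=
  [set z | X (lam B (pt z t) x) /\ forall i, i \in B -> i != x ->
     half_open_ge0 (lam B u i) (lam B (pt z t) i) /\
     (i \in J -> ~~ half_open_ge0 (lam B u i) (lam B (pt z t) i - 1))]%classic.

(** [X] will be the point [0] with [e = 0], for the boundary, and the open unit interval with
    [e = 1], for the interior. *)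
Variables (X : R -> bool) (e : nat).
Hypothesis X_bounds : forall l, X l -> 0 <= l <= e%:R.
Hypothesis X_reflect : forall l, X l -> X (e%:R - l).

Lemma finite_slice u J t : finite_set (slice u X J t).
Proof.
apply: sub_finite_set (finite_lattice_cone t) => z [/X_bounds/andP[Xz _] Hz].
rewrite /= (coordinates_expand (pt z t) (coordsP basisB)); apply: cone_sum => i iB.
apply: coneZ; last exact: cone_row.
by have [->//|ix] := eqVneq i x; have [/half_open_ge0_ge0] := Hz i iB ix.
Qed.

(** Translation by [gz i0], of height [q], identifies the slice at height [t - q] with the points at
    height [t] beyond the cut-off, so the difference counts those below it. *)
Lemma bdiff_slice u (J : {set 'I_m}) i0 : i0 \in B -> i0 != x -> i0 \notin J ->
  bdiff q (fun t => (cnt (slice u X J t))%:Z) = fun t => (cnt (slice u X (i0 |: J) t))%:Z.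
Proof.
move=> i0B i0x i0J; apply/funext => t; rewrite /bdiff.
pose A := [set z | ~~ half_open_ge0 (lam B u i0) (lam B (pt z t) i0 - 1)]%classic.
rewrite (cnt_setID A (finite_slice u J t)) PoszD.
have -> : (slice u X J t `&` A)%classic = slice u X (i0 |: J) t.
  apply/seteqP; split=> z.
    case=> -[Xz Hz] Az; split=> // i iB ix; have [H1 H2] := Hz i iB ix.
    by split=> //; rewrite !inE => /orP[/eqP->|/H2].
  case=> Xz Hz; split; last by have [_] := Hz i0 i0B i0x; apply; rewrite !inE eqxx.
  split=> // i iB ix; have [H1 H2] := Hz i iB ix; split=> // iJ.
  by apply: H2; rewrite !inE iJ orbT.
apply/eqP; rewrite -addrA -[X in _ == X]addr0 (inj_eq (addrI _)) subr_eq0; apply/eqP.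
have shift z t' i : lam B (pt (z + gz i0) (t' + q)) i = lam B (pt z t') i + (i == i0)%:R.
  by rewrite -(htq i0x) lattice_ptD lamD lam_gen.
(* Below height [q] nothing is beyond the cut-off: an [i0]-coordinate of at least [1] alone
   contributes height [q]. *)
case: ifPn => [qt|]; last first.
  rewrite -ltnNge => tq; rewrite (_ : (_ `\` _)%classic = set0) ?cnt0 //.
  apply/seteqP; split=> // z [[Xz Hz] /negP]; rewrite negbK => /half_open_ge0_ge0.
  rewrite subr_ge0 => l1; exfalso.
  have := height_coords z t; rewrite (bigD1 i0) //= htq // => tE.
  have : q%:R <= t%:R :> R; last by rewrite ler_nat leqNgt tq.
  rewrite tE ler_wpDr //; last by rewrite ler_peMl.
  apply: sumr_ge0 => i /andP[iB _]; rewrite mulr_ge0 //.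
  have [->|ix] := eqVneq i x; first by have /andP[] := X_bounds Xz.
  by have [/half_open_ge0_ge0] := Hz i iB ix.
congr Posz; rewrite -(cnt_image (f := fun z => z + gz i0) (finite_slice u J (t - q))); last first.
  by move=> a b /addIr.
congr cnt; apply/seteqP; split=> z.
  case=> -[Xz Hz] /negP; rewrite negbK => l1.
  exists (z - gz i0); last by rewrite subrK.
  have lE i : lam B (pt z t) i = lam B (pt (z - gz i0) (t - q)) i + (i == i0)%:R.
    by rewrite -shift subrK subnK.
  split; first by move: Xz; rewrite lE eq_sym (negbTE i0x) addr0.
  move=> i iB ix; have [H1 H2] := Hz i iB ix; split.
    have [->|ii0] := eqVneq i i0; first by move: l1; rewrite lE eqxx addrK.
    by move: H1; rewrite lE (negbTE ii0) addr0.
  move=> iJ; have ii0 : i != i0 by apply: contraNneq i0J => <-.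
  by have := H2 iJ; rewrite lE (negbTE ii0) addr0.
case=> y [Xy Hy] <-.
have lE i : lam B (pt (y + gz i0) t) i = lam B (pt y (t - q)) i + (i == i0)%:R.
  by rewrite -shift subnK.
split; last first.
  by have [H1 _] := Hy i0 i0B i0x; apply/negP; rewrite negbK lE eqxx addrK.
split; first by rewrite lE eq_sym (negbTE i0x) addr0.
move=> i iB ix; have [H1 H2] := Hy i iB ix; rewrite lE.
have [ii0|ii0] := eqVneq i i0; last by rewrite addr0.
split; last by rewrite ii0 (negbTE i0J).
move: H1 => /half_open_ge0E[H1 H1']; apply/half_open_ge0E.
by split=> [|_]; [rewrite addr_ge0|rewrite ltr_wpDl].
Qed.

Lemma card_basisD1 : #|B :\ x| = d.
Proof.
by have := cardsD1 x B; rewrite xB (card_basis (coordsP basisB)) addnC => /addnI.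
Qed.

Lemma iter_bdiff_slice u :
  iter d (bdiff q) (fun t => (cnt (slice u X finset.set0 t))%:Z) =
  fun t => (cnt (slice u X (B :\ x) t))%:Z.
Proof.
have H (s : seq 'I_m) : uniq s -> {subset s <= B :\ x} ->
    iter (size s) (bdiff q) (fun t => (cnt (slice u X finset.set0 t))%:Z) =
    fun t => (cnt (slice u X [set i in s] t))%:Z.
  elim: s => [|i s IH] /=.
    by move=> _ _; apply/funext => t; congr (Posz (cnt (slice u X _ t))).
  move=> /andP[si us] sB; rewrite IH //; last by move=> j js; apply: sB; rewrite inE js orbT.
  have := sB i (mem_head _ _); rewrite !inE => /andP[ix iB].
  rewrite (@bdiff_slice u _ i) ?inE //; apply/funext => t.
  by congr (Posz (cnt (slice u X _ t))); apply/setP => j; rewrite !inE.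
have := H (enum (B :\ x)) (enum_uniq _); rewrite -cardE card_basisD1 => ->.
  by apply/funext => t; congr (Posz (cnt (slice u X _ t))); apply/setP => j; rewrite inE mem_enum.
by move=> i; rewrite mem_enum.
Qed.

(** The corner opposite to the origin; the box is symmetric about half of it. *)
Let box_sum : 'rV[int]_d := \sum_(i in B :\ x) gz i + gz x *+ e.

Lemma lam_box_sum i : i \in B ->
  lam B (pt box_sum (q * d + e * k)) i = if i == x then e%:R else 1.
Proof.
move=> iB; have -> : pt box_sum (q * d + e * k) =
    \sum_(j in B :\ x) pt (gz j) (ht j) + \sum_(j < e) pt (gz x) (ht x).
  rewrite -!lattice_pt_sum -lattice_ptD sumr_const card_ord; congr pt.
  rewrite (eq_bigr (fun => q)) => [|j]; last by rewrite !inE => /andP[/htq].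
  by rewrite !sum_nat_const card_basisD1 card_ord htx mulnC.
rewrite lamD !mulmx_suml !summxE sumr_const card_ord lam_gen //.
rewrite (eq_bigr (fun j => (j == i)%:R)) => [|j]; last first.
  by rewrite !inE => /andP[_ jB]; rewrite lam_gen // eq_sym.
have [->|ix] := eqVneq i x.
  rewrite big1 ?add0r // => j; rewrite !inE => /andP[/negbTE-> _]; by [].
rewrite mul0rn addr0 (bigD1 i) ?inE ?ix //= eqxx big1 ?addr0 // => j /andP[_ /negbTE->].
by [].
Qed.

Lemma slice_box_le u z t i : slice u X (B :\ x) t z -> i \in B ->
  lam B (pt z t) i <= lam B (pt box_sum (q * d + e * k)) i.
Proof.
move=> [Xz Hz] iB; rewrite lam_box_sum //.
have [->|ix] := eqVneq i x; first by have /andP[] := X_bounds Xz.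
have [_] := Hz i iB ix; rewrite !inE ix iB => /(_ isT).
by rewrite /half_open_ge0; case: ifP => _; rewrite -?leNgt -?ltNge ?subr_le0 ?subr_lt0 // => /ltW.
Qed.

Lemma slice_box_height u z t : slice u X (B :\ x) t z -> (t <= q * d + e * k)%N.
Proof.
move=> Hz; rewrite -(ler_nat R) (height_coords z) (height_coords box_sum).
by apply: ler_sum => i iB; rewrite ler_wpM2r // (slice_box_le Hz).
Qed.

(** Each coordinate [l] goes to [1 - l], or to [e - l] at [x], which trades the sides removed for
    [u] for those removed for [- u]. *)
Lemma slice_reflect u z t : (forall i, i \in B -> lam B u i != 0) ->
  slice u X (B :\ x) t z ->
  slice (- u) X (B :\ x) (q * d + e * k - t) (box_sum - z).
Proof.
move=> u0 Hz; have tH := slice_box_height Hz; have [Xz Hz'] := Hz.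
have lE i : i \in B -> lam B (pt (box_sum - z) (q * d + e * k - t)) i =
    (if i == x then e%:R else 1) - lam B (pt z t) i.
  move=> iB; rewrite -lam_box_sum //.
  by rewrite -[in RHS](subrK z box_sum) -{2}(subnK tH) lattice_ptD lamD addrK.
split; first by rewrite lE // eqxx; exact: X_reflect.
move=> i iB ix; rewrite lE // (negbTE ix) mulNmx [(- _ : 'rV_m) _ _]mxE.
have [H1 H2] := Hz' i iB ix.
rewrite half_open_ge0_reflect ?u0 //; split; first by apply: H2; rewrite !inE ix.
move=> _; rewrite addrAC subrr add0r.
have := @half_open_ge0_reflect (- lam B u i) (1 - lam B (pt z t) i).
rewrite oppr_eq0 => /(_ (u0 i iB)).
by rewrite opprK opprB addrC subrK addrAC subrr add0r => <-.
Qed.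

Lemma cnt_slice_reflect u t : (forall i, i \in B -> lam B u i != 0) ->
  (t <= q * d + e * k)%N ->
  cnt (slice u X (B :\ x) t) = cnt (slice (- u) X (B :\ x) (q * d + e * k - t)).
Proof.
move=> u0 tH; rewrite -(cnt_image (f := fun z => box_sum - z) (finite_slice u _ t)); last first.
  by move=> a b /addrI/oppr_inj.
congr cnt; apply/seteqP; split=> z; first by case=> y Hy <-; exact: slice_reflect.
move=> Hz; exists (box_sum - z); last by rewrite opprB addrC subrK.
rewrite -[u]opprK -(subKn tH); apply: slice_reflect => // i iB.
by rewrite mulNmx mxE oppr_eq0 u0.
Qed.

End Boxes.

Section BoxTotal.
Variables (R : rcfType) (d m q k : nat) (gz : 'I_m -> 'rV[int]_d) (ht : 'I_m -> nat).
Variable x : 'I_m.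
Hypotheses (q0 : (0 < q)%N) (k0 : (0 < k)%N).
Hypothesis htx : ht x = k.
Hypothesis htq : forall i, i != x -> ht i = q.
Local Notation pt := (@lattice_pt R d).
Local Notation G := (@lattice_gens R d m gz ht).
Local Notation lam B p i := ((p *m coords G B) 0 i).
Hypothesis fullG : row_full G.
Hypothesis intx : cone_interior G (row x G).
Variable c : 'cV[R]_m.
Hypothesis goodc : good_heights G x c.
Variables (X : R -> bool) (e : nat).
Hypothesis X_bounds : forall l, X l -> 0 <= l <= e%:R.
Hypothesis X_reflect : forall l, X l -> X (e%:R - l).
Variable S : nat -> set 'rV[int]_d.
Hypothesis S_cone : forall t z, S t z -> cone G (pt z t).
Hypothesis SX : forall u B t z, lower_facet G c B -> half_open G x u B (pt z t) ->
  S t z <-> X (lam B (pt z t) x).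

(** The half-open pieces partition [S t] into slices, and [d] differences cut each slice down to a
    box. The left side does not involve [u]. *)
Lemma iter_bdiff_cnt u : generic G u ->
  iter d (bdiff q) (fun t => (cnt (S t))%:Z) = fun t =>
  (\sum_(B | `[< lower_facet G c B >]) cnt (slice gz ht x B u X (B :\ x) t))%N%:Z.
Proof.
move=> gu.
have -> : (fun t => (cnt (S t))%:Z) = fun t =>
   \sum_(B | `[< lower_facet G c B >]) (cnt (slice gz ht x B u X finset.set0 t))%:Z.
  apply/funext => t; rewrite (@cnt_partition _ _ (fun B => `[< lower_facet G c B >])
    (fun B => slice gz ht x B u X finset.set0 t)).
  - by rewrite (big_morph Posz PoszD (erefl _)).
  - apply: (sub_finite_set (S_cone (t := t))).
    exact: (finite_lattice_cone R gz q0 k0 htx htq).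
  - move=> z Sz; have [B [[fB hB] uB]] := half_open_decomposition fullG
      (height_lattice_gens R gz q0 k0 htx htq) intx goodc gu (S_cone Sz).
    have sl B' : lower_facet G c B' ->
        slice gz ht x B' u X finset.set0 t z <-> half_open G x u B' (pt z t).
      move=> fB'; have [bB' _] := fB'; split=> [[Xz Hz] i iB|hB'].
        have [->|ix] := eqVneq i x; first by have /andP[] := X_bounds Xz.
        by have [/half_open_ge0E[? ?] _] := Hz i iB ix.
      split=> [|i iB ix]; first by apply/(SX fB' hB').
      by have [h1 h2] := hB' i iB; split; [apply/half_open_ge0E; split=> //; exact: h2|rewrite inE].
    exists B; split; first by split; [exact/asboolP|apply/sl].
    by move=> B' [/asboolP fB' /(sl _ fB') hB']; apply: uB.
  - move=> B /asboolP fB z [Xz Hz]; apply/(SX (u := u) fB) => // i iB.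
    have [->|ix] := eqVneq i x; first by have /andP[] := X_bounds Xz.
    by have [/half_open_ge0E[? ?] _] := Hz i iB ix.
rewrite iter_bdiff_sum; apply/funext => t; rewrite (big_morph Posz PoszD (erefl _)).
apply: eq_bigr => B /asboolP fB.
rewrite (iter_bdiff_slice q0 k0 htx htq (proj1 fB) (lower_facet_mem goodc fB) X_bounds) //.
Qed.

Lemma box_total_exists : exists A : nat -> nat,
  [/\ iter d (bdiff q) (fun t => (cnt (S t))%:Z) = (fun t => (A t)%:Z),
      forall t, (q * d + e * k < t)%N -> A t = 0%N
    & forall t, (t <= q * d + e * k)%N -> A t = A (q * d + e * k - t)%N].
Proof.
have [u gu] := generic_exists G.
pose A u t := (\sum_(B | `[< lower_facet G c B >]) cnt (slice gz ht x B u X (B :\ x) t))%N.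
exists (A u); split; first exact: iter_bdiff_cnt.
- move=> t tH; apply: big1 => B /asboolP fB; rewrite (_ : slice _ _ _ _ _ _ _ _ = set0) ?cnt0 //.
  apply/seteqP; split=> // z Hz; exfalso.
  have := slice_box_height htx htq (proj1 fB) (lower_facet_mem goodc fB) X_bounds Hz.
  by rewrite leqNgt tH.
(* Reflection turns the boxes of [u] into those of [- u], and both have the same total count because
   it is determined by [S]. *)
- move=> t tH; have AN : A u = A (- u).
    have := iter_bdiff_cnt gu; rewrite (iter_bdiff_cnt (genericN gu)) => H.
    by apply/funext => s; have := congr1 (fun f => f s) H => -[].
  rewrite {2}AN; apply: eq_bigr => B /asboolP fB.
  apply: (cnt_slice_reflect q0 k0 htx htq (proj1 fB) (lower_facet_mem goodc fB)) => //.
  by move=> i iB; apply: gu => //; case: fB.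
Qed.

End BoxTotal.

Lemma iter_bdiff_eq0 q n k (f : nat -> int) :
  (forall t, (t < k)%N -> f t = 0) -> forall t, (t < k)%N -> iter n (bdiff q) f t = 0.
Proof.
move=> f0; elim: n => //= n IH t tk; rewrite /bdiff IH // sub0r.
by case: ifP => // _; rewrite IH ?oppr0 // (leq_ltn_trans (leq_subr _ _)).
Qed.

Lemma iter_bdiff_at0 q n (f : nat -> int) : (0 < q)%N -> iter n (bdiff q) f 0%N = f 0%N.
Proof. by move=> q0; elim: n => //= n IH; rewrite /bdiff IH leqNgt q0 subr0. Qed.

(** * Boundary and interior lattice points of the cone *)

Section EhrhartCone.
Variables (R : rcfType) (d n q : nat) (gz : 'I_n -> 'rV[int]_d).
Hypothesis q0 : (0 < q)%N.
Local Notation pt := (@lattice_pt R d).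
Local Notation eta := (@height_form R d).
Let G : 'M[R]_(n, d + 1) := lattice_gens R gz (fun => q).
Hypothesis fullG : row_full G.

Lemma cone_height_ge0 p : cone G p -> 0 <= (p *m eta) 0 0.
Proof.
case=> l l0 ->; rewrite -mulmxA mxE; apply: sumr_ge0 => i _.
by rewrite mulr_ge0 // entry_mulmx_col rowK height_lattice_pt.
Qed.

Lemma cone_height0 z : cone G (pt z 0) -> z = 0.
Proof.
case=> l l0 zl.
have : \sum_i l 0 i * (G *m eta) i 0 = 0.
  by have := height_lattice_pt R z 0; rewrite zl -mulmxA mxE.
have Gq i : (G *m eta) i 0 = q%:R by rewrite entry_mulmx_col rowK height_lattice_pt.
move/psumr_eq0P => H.
have {}H i : l 0 i = 0.
  have /eqP := H (fun i _ => mulr_ge0 (l0 i) (eq_ind_r (fun y => 0 <= y) (ler0n _ q) (Gq i))) i isT.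
  by rewrite Gq mulf_eq0 pnatr_eq0 (gtn_eqF q0) orbF => /eqP.
have l00 : l = 0 by apply/rowP => i; rewrite H mxE.
by move: zl; rewrite l00 mul0mx -lattice_pt0 => /lattice_pt_inj[].
Qed.

Lemma interior_height_gt0 z t : cone_interior G (pt z t) -> (0 < t)%N.
Proof.
move=> /(_ (- pt 0 1))[e e0 /cone_height_ge0].
rewrite scalerN mulmxBl -scalemxAl mxE [(- _ : 'M_1) _ _]mxE [(_ *: _ : 'M_1) _ _]mxE.
rewrite !height_lattice_pt mulr1 subr_ge0 => et; rewrite -(ltr0n R).
exact: lt_le_trans et.
Qed.

(** The sum of all generators is interior: they span, so a direction is a combination [a] of them,
    and after division by [M] the coefficients of [a] stay above [-1]. *)
Lemma interior_exists : exists t z, cone_interior G (pt z t).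
Proof.
exists (\sum_(i < n) q)%N, (\sum_i gz i) => y.
have [a ->] : exists a, y = a *m G.
  by exists (y *m pinvmx G); rewrite mulmxKpV // submx_full.
pose M := \sum_i `|a 0 i| + 1.
have M0 : 0 < M by rewrite ltr_wpDl // sumr_ge0.
exists M^-1; first by rewrite invr_gt0.
exists (const_mx 1 + M^-1 *: a).
  move=> i; rewrite !mxE -lerBlDl sub0r.
  have : `|a 0 i| <= M.
    rewrite /M (bigD1 i) //= -addrA ler_wpDr // addr_ge0 // sumr_ge0 //.
  move=> aM; rewrite mulrC ler_pdivlMr // mulN1r lerNl.
  by apply: le_trans aM; rewrite -normrN ler_norm.
rewrite mulmxDl -scalemxAl; congr (_ + _).
rewrite lattice_pt_sum mulmx_sum_row; apply: eq_bigr => i _.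
by rewrite mxE scale1r rowK.
Qed.

Lemma ehrhart_box_decomposition :
  let E t := (cnt [set z | cone G (pt z t)]%classic)%:Z in
  exists k (A D : nat -> nat),
  [/\ (0 < k)%N,
      iter d (bdiff q) (bdiff k E) = (fun t => (A t + D t)%N%:Z),
      [/\ A 0%N = 1%N, forall t, (q * d < t)%N -> A t = 0%N
        & forall t, (t <= q * d)%N -> A t = A (q * d - t)%N]
    & [/\ forall t, (t < k)%N -> D t = 0%N, forall t, (q * d + k < t)%N -> D t = 0%N
        & forall t, (t <= q * d + k)%N -> D t = D (q * d + k - t)%N]].
Proof.
move=> E.
have : exists t, `[< exists z, cone_interior G (pt z t) >].
  by have [t [z H]] := interior_exists; exists t; apply/asboolP; exists z.
(* The minimality of [k] is what makes [D] vanish below [k]. *)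
case/ex_minnP => k /asboolP[xz intx] kmin.
have k0 := interior_height_gt0 intx; exists k.
have Cx : cone G (pt xz k).
  by have [e _] := intx 0; rewrite scaler0 addr0.
(* The interior point joins the generators at index [0]; this changes neither the cone nor its
   interior, and makes it the common ray of the triangulation. *)
pose x : 'I_n.+1 := ord0.
pose gz' (i : 'I_n.+1) := if unlift ord0 i is Some j then gz j else xz.
pose ht (i : 'I_n.+1) := if unlift ord0 i is Some j then q else k.
have htx : ht x = k by rewrite /ht unlift_none.
have htq i : i != x -> ht i = q.
  by rewrite /ht; case: unliftP => [j ->//|->]; rewrite eqxx.
pose G' := lattice_gens R gz' ht.
have rowx : row x G' = pt xz k by rewrite rowK /gz' /ht unlift_none.
have rowj j : row (lift ord0 j) G' = row j G by rewrite !rowK /gz' /ht liftK.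
have CE p : cone G' p <-> cone G p.
  split; apply: sub_cone => i; last by rewrite -rowj; exact: cone_row.
  by case: (unliftP ord0 i) => [j ->|->]; [rewrite rowj; exact: cone_row|rewrite rowx].
have IE p : cone_interior G' p <-> cone_interior G p.
  by split=> H y; have [e e0 /CE He] := H y; exists e.
have fullG' : row_full G'.
  rewrite -sub1mx; apply: (@submx_trans _ _ _ _ _ _ G); first by rewrite sub1mx.
  by apply/row_subP => j; rewrite -rowj; exact: row_sub.
have intx' : cone_interior G' (row x G') by apply/IE; rewrite rowx.
have [c goodc] := good_heights_exist G' x.
pose C t := [set z | cone G (pt z t)]%classic.
pose I t := [set z | cone_interior G (pt z t)]%classic.
pose K t := [set z | cone G (pt z t - pt xz k)]%classic.
have finC t : finite_set (C t).
  apply: sub_finite_set (finite_lattice_cone R gz' q0 k0 htx htq t) => z Cz.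
  exact/CE.
pose X0 (l : R) := l == 0; pose X1 (l : R) := 0 < l < 1.
have X0b l : X0 l -> 0 <= l <= 0%N%:R by move=> /eqP->; rewrite lexx.
have X0r l : X0 l -> X0 (0%N%:R - l) by move=> /eqP->; rewrite /X0 subrr.
have X1b l : X1 l -> 0 <= l <= 1%N%:R by case/andP => l0 l1; rewrite !ltW.
have X1r l : X1 l -> X1 (1%N%:R - l).
  by case/andP => l0 l1; rewrite /X1 subr_gt0 l1 ltrBlDr ltrDl.
(* Boundary points are those with [x]-coordinate [0]. *)
have [|u B t z fB hB|A [HA A0 Ar]] := box_total_exists q0 k0 htx htq fullG' intx' goodc X0b X0r
  (S := fun t => (C t `\` I t)%classic).
- by move=> t z [/CE].
- have [bB _] := fB; have := half_open_interior intx' goodc fB hB.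
  have [l0 _] := hB x (lower_facet_mem goodc fB).
  rewrite /X0 eq_le l0 andbT leNgt => ->; split.
    by case=> _ nI; apply/negP => /asboolP/IE.
  move=> /negP nI; split; first by apply/CE; exact: half_open_cone bB hB.
  by move=> Iz; apply: nI; apply/asboolP/IE.
(* Interior points that leave the cone when the vector of index [x] is subtracted have
   [x]-coordinate in []0, 1[]. *)
have [|u B t z fB hB|D [HD D0 Dr]] := box_total_exists q0 k0 htx htq fullG' intx' goodc X1b X1r
  (S := fun t => ((C t `&` I t) `\` K t)%classic).
- by move=> t z [[/CE]].
- have [bB _] := fB; have h1 := half_open_interior intx' goodc fB hB.
  have := half_open_shift goodc 1 fB hB; rewrite scale1r rowx => h2.
  rewrite /X1 h1 ltNge h2; split.
    case=> -[_ Iz] Kz; apply/andP; split; first by apply/asboolP/IE.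
    by apply/negP => /asboolP/CE.
  case/andP => /asboolP/IE Iz /negP Kz; split; last by move=> /CE Kz'; apply: Kz; exact/asboolP.
  by split=> //; apply/CE; exact: half_open_cone bB hB.
rewrite !mul0n !addn0 in A0 Ar; rewrite !mul1n in D0 Dr.
exists A, D; split=> //.
(* [K t] is a translate of [C (t - k)] lying in the interior; removing it from [C t] leaves the two
   sets behind [A] and [D]. *)
- have -> : bdiff k E = fun t =>
      (cnt (C t `\` I t)%classic)%:Z + (cnt ((C t `&` I t) `\` K t)%classic)%:Z.
    apply/funext => t; rewrite /bdiff /E (cnt_setID (I t) (finC t)).
    rewrite (cnt_setID (A := (C t `&` I t)%classic) (K t)); last first.
      exact: sub_finite_set (@subIsetl _ _ _) (finC t).
    have -> : ((C t `&` I t) `&` K t)%classic = K t.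
      apply/seteqP; split=> z; first by case.
      move=> Kz; split=> //; split.
        by rewrite /C /= -(subrK (pt xz k) (pt z t)); exact: coneD.
      apply/IE; apply: (cone_interior_sub intx' (e := 1)) => //.
      by rewrite scale1r rowx; exact/CE.
    have -> : (if (k <= t)%N then (cnt (C (t - k)%N))%:Z else 0) = (cnt (K t))%:Z.
      case: ifPn => kt.
        rewrite -(cnt_image (f := fun z => z + xz) (finC _)); last by move=> a b /addIr.
        congr (Posz (cnt _)); apply/seteqP; split=> z.
          by case=> y Cy <-; rewrite /K /= -(subnK kt) lattice_ptD addrK.
        move=> Kz; exists (z - xz); last by rewrite subrK.
        rewrite /C /=; move: Kz; rewrite /K /= -{1}(subrK xz z) -{1}(subnK kt) lattice_ptD.
        by rewrite addrK.
      rewrite (_ : K t = set0) ?cnt0 //; apply/seteqP; split=> // z /cone_height_ge0.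
      rewrite mulmxBl mxE [(- _ : 'M_1) _ _]mxE !height_lattice_pt subr_ge0 ler_nat.
      by rewrite (negbTE kt).
    by rewrite !PoszD; ring.
  have add f g : bdiff q (fun t => f t + g t) = fun t => bdiff q f t + bdiff q g t.
    by apply/funext => t; rewrite /bdiff; case: ifP => _; lia.
  have iadd N f g : iter N (bdiff q) (fun t => f t + g t) =
      fun t => iter N (bdiff q) f t + iter N (bdiff q) g t.
    by elim: N => //= N ->; rewrite add.
  by rewrite iadd HA HD; apply/funext => t; rewrite PoszD.
(* At height [0] the cone contains only the origin, which is not interior. *)
- split=> //; have := congr1 (fun f => f 0%N) HA; rewrite /= iter_bdiff_at0 // => -[<-].
  rewrite (_ : (_ `\` _)%classic = [set 0]%classic) ?cnt1 //; apply/seteqP; split=> z.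
    by case=> /cone_height0.
  move=> ->; split; first by rewrite /C /= lattice_pt0; exact: cone0.
  by move/interior_height_gt0.
- split=> // t tk; have := congr1 (fun f => f t) HD; rewrite /=.
  rewrite (@iter_bdiff_eq0 _ _ k) // => [[<-]//|s sk]; congr Posz.
  rewrite (_ : (_ `\` _)%classic = set0) ?cnt0 //; apply/seteqP; split=> // z [[_ Iz] _].
  have /kmin : `[< exists z, cone_interior G (pt z s) >] by apply/asboolP; exists z.
  by rewrite leqNgt sk.
Qed.

End EhrhartCone.

(** * Power series and self-reciprocal polynomials *)

Section Convolution.

Definition conv (p : {poly int}) (f : nat -> int) (n : nat) : int :=
  \sum_(i < n.+1) p`_i * f (n - i)%N.

(** Truncation reduces identities of power series to identities of polynomials. *)
Lemma conv_trunc N p f n : (n < N)%N -> conv p f n = (p * \poly_(i < N) f i)`_n.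
Proof.
move=> nN; rewrite coefM; apply: eq_bigr => i _.
by rewrite coef_poly (leq_ltn_trans (leq_subr _ _) nN).
Qed.

Lemma conv_coef (p r : {poly int}) : conv p (fun n => r`_n) = fun n => (p * r)`_n.
Proof. by apply/funext => n; rewrite coefM. Qed.

Lemma convM p r f : conv (p * r) f = conv p (conv r f).
Proof.
apply/funext => n; rewrite (@conv_trunc n.+1) // -mulrA coefM.
by apply: eq_bigr => i _; rewrite -conv_trunc // ltnS leq_subr.
Qed.

Lemma conv_bdiff q f : conv (1 - 'X^q) f = bdiff q f.
Proof.
apply/funext => n; rewrite (@conv_trunc n.+1) // mulrBl mul1r coefB coefXnM !coef_poly ltnSn.
by rewrite /bdiff (leq_ltn_trans (leq_subr q n)) // ltnNge; case: (q <= n)%N.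
Qed.

Lemma conv_exp_bdiff q d f : conv ((1 - 'X^q) ^+ d) f = iter d (bdiff q) f.
Proof.
elim: d => [|d IH]; last by rewrite exprS convM IH conv_bdiff.
by apply/funext => n; rewrite (@conv_trunc n.+1) // expr0 mul1r coef_poly ltnSn.
Qed.

End Convolution.

Section SelfReciprocal.
Local Notation F := {fraction {poly int}}.
Local Notation z := (tofrac 'X : F).

Lemma tofracX_neq0 : z != 0.
Proof. by rewrite tofrac_eq0 polyX_eq0. Qed.

Definition eval_inv (p : {poly int}) : F := (map_poly (intr : int -> F) p).[z^-1].

Lemma eval_invM p r : eval_inv (p * r) = eval_inv p * eval_inv r.
Proof. by rewrite /eval_inv rmorphM hornerM. Qed.

Lemma eval_invB p r : eval_inv (p - r) = eval_inv p - eval_inv r.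
Proof. by rewrite /eval_inv rmorphB hornerD hornerN. Qed.

Lemma eval_invXn n : eval_inv 'X^n = z ^- n.
Proof. by rewrite /eval_inv map_polyXn hornerXn exprVn. Qed.

Lemma self_reciprocalE m p : self_reciprocal m p <-> tofrac p = z ^ m * eval_inv p.
Proof. by []. Qed.

Lemma self_reciprocalM m m' p r :
  self_reciprocal m p -> self_reciprocal m' r -> self_reciprocal (m + m') (p * r).
Proof.
rewrite !self_reciprocalE => hp hr; rewrite rmorphM /= hp hr eval_invM.
by rewrite expfzDr ?tofracX_neq0 //; ring.
Qed.

Lemma self_reciprocalB m p r :
  self_reciprocal m p -> self_reciprocal m r -> self_reciprocal m (p - r).
Proof.
by rewrite !self_reciprocalE => hp hr; rewrite rmorphB /= hp hr eval_invB mulrBr.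
Qed.

(** The factor ['X^k] gives [z ^ k] on the left and [z ^- k] on the right, so cancelling it lowers
    the exponent by twice [k]. *)
Lemma self_reciprocal_divX m k p :
  self_reciprocal m ('X^k * p) -> self_reciprocal (m - k%:Z - k%:Z) p.
Proof.
rewrite !self_reciprocalE eval_invM eval_invXn rmorphM rmorphXn /= => h.
have zk : z ^+ k != 0 by rewrite expf_neq0 // tofracX_neq0.
rewrite !expfzDr ?tofracX_neq0 // -!exprnN.
have aux (K : fieldType) (a b c : K) : c != 0 -> a * (c^-1 * b) = c * (a / c / c * b).
  by move=> c0; field.
by apply: (mulfI zk); rewrite h; exact: aux.
Qed.

Lemma palindromic_self_reciprocal m (p : {poly int}) : (size p <= m.+1)%N ->
  (forall i, (i <= m)%N -> p`_i = p`_(m - i)) -> self_reciprocal m%:Z p.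
Proof.
move=> sp hp; rewrite self_reciprocalE.
have -> : eval_inv p = \sum_(i < m.+1) (p`_i)%:~R * z ^- i.
  rewrite /eval_inv (@horner_coef_wide _ m.+1); last first.
    by apply: leq_trans sp; exact: size_poly.
  by apply: eq_bigr => i _; rewrite coef_map exprVn.
have -> : tofrac p = \sum_(i < m.+1) (p`_i)%:~R * z ^+ i.
  have {1}-> : p = \sum_(i < m.+1) (p`_i)%:~R * 'X^i.
    have {1}-> : p = \poly_(i < m.+1) p`_i.
      apply/polyP => i; rewrite coef_poly; case: ltnP => // mi.
      by rewrite nth_default // (leq_trans sp).
    rewrite poly_def; apply: eq_bigr => i _.
    by rewrite -mul_polyC -[X in X%:P]intz rmorph_int.
  by rewrite rmorph_sum; apply: eq_bigr => i _; rewrite rmorphM rmorph_int rmorphXn.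
rewrite mulr_sumr (reindex_inj rev_ord_inj) /=; apply: eq_bigr => i _.
have im : (i <= m)%N by rewrite -ltnS.
rewrite subSS -hp // -exprnP [z ^+ m](_ : _ = z ^+ (m - i) * z ^+ i); last by rewrite -exprD subnK.
have zk : z ^+ i != 0 by rewrite expf_neq0 // tofracX_neq0.
by rewrite mulrCA [X in _ = _ * X]mulfK.
Qed.

(** The two [a] parts differ by [- 'X^l * (b - b')]. Both reciprocity laws together give
    ['X^l * (b - b') = b - b'], so the difference vanishes as [l] is positive. *)
Lemma decomposition_unique (M : int) l (a b a' b' : {poly int}) : (0 < l)%N ->
  a + 'X^l * b = a' + 'X^l * b' ->
  self_reciprocal M a -> self_reciprocal (M - l%:Z) b ->
  self_reciprocal M a' -> self_reciprocal (M - l%:Z) b' -> a = a' /\ b = b'.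
Proof.
move=> l0 e ha hb ha' hb'.
have hA := self_reciprocalB ha ha'; have hB := self_reciprocalB hb hb'.
have AE : a - a' = - ('X^l * (b - b')) 
  by have -> : a = a' + 'X^l * b' - 'X^l * b by [rewrite -e addrK]; ring.
move: hA hB; rewrite !self_reciprocalE AE => hA hB.
have zl : z ^+ l != 0 by rewrite expf_neq0 // tofracX_neq0.
have AB : 'X^l * (b - b') = b - b'.
  apply/eqP; rewrite -tofrac_eq; apply/eqP.
  transitivity (- (tofrac (- ('X^l * (b - b'))) : F)); first by rewrite rmorphN opprK.
  rewrite hA -[X in eval_inv X]sub0r eval_invB eval_invM eval_invXn.
  rewrite /eval_inv rmorph0 horner0 -/(eval_inv (b - b')) sub0r hB.
  by rewrite expfzDr ?tofracX_neq0 // -exprnN mulrN opprK mulrA.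
have : ('X^l - 1%:P) * (b - b') = 0 by rewrite mulrBl mul1r AB subrr.
move/eqP; rewrite mulf_eq0 -size_poly_eq0 size_XnsubC //= subr_eq0 => /eqP bb.
by split=> //; move: e; rewrite bb => /addIr.
Qed.

End SelfReciprocal.

(** In [(1 - 'X^k) * h = (1 - 'X^q) * (PA + PD)] degrees determine [k]; cancelling [1 - 'X] then
    leaves the decomposition. *)
Lemma hstar_decomposition (q d k : nat) (A D : nat -> nat) (h : {poly int}) :
  (0 < q)%N -> (0 < k)%N ->
  conv (1 - 'X^k) (fun n => h`_n) = conv (1 - 'X^q) (fun n => (A n + D n)%N%:Z) ->
  [/\ A 0%N = 1%N, forall t, (q * d < t)%N -> A t = 0%N
        & forall t, (t <= q * d)%N -> A t = A (q * d - t)%N] ->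
  [/\ forall t, (t < k)%N -> D t = 0%N, forall t, (q * d + k < t)%N -> D t = 0%N
        & forall t, (t <= q * d + k)%N -> D t = D (q * d + k - t)%N] ->
  let l := (q * d.+1 - (size h).-1)%N in
  l = k /\ exists a b : {poly int},
  [/\ (\sum_(i < l) 'X^i) * h = a + 'X^l * b,
        self_reciprocal ((q * d.+1)%:Z - 1) a,
        self_reciprocal ((q * d.+1)%:Z - 1 - l%:Z) b,
        forall i, 0 <= a`_i & forall i, 0 <= b`_i].
Proof.
move=> q0 k0 hAD [A0 Aq Ar] [Dk Dq Dr] l.
pose PA : {poly int} := \poly_(i < (q * d).+1) (A i)%:Z.
pose PD : {poly int} := \poly_(i < (q * d + k).+1) (D i)%:Z.
have PAE i : PA`_i = (A i)%:Z.
  by rewrite coef_poly; case: ltnP => // h1; rewrite Aq.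
have PDE i : PD`_i = (D i)%:Z.
  by rewrite coef_poly; case: ltnP => // h1; rewrite Dq.
have eq1 : (1 - 'X^k) * h = (1 - 'X^q) * (PA + PD).
  apply/polyP => i; have := congr1 (fun f => f i) hAD; rewrite conv_coef => ->.
  rewrite (_ : (fun n => _) = fun n => (PA + PD)`_n) ?conv_coef //.
  by apply/funext => n; rewrite coefD PAE PDE.
have size1X n : (0 < n)%N -> size (1 - 'X^n : {poly int}) = n.+1.
  by move=> n0; rewrite -opprB size_polyN size_XnsubC.
have neq1X n : (0 < n)%N -> (1 - 'X^n : {poly int}) != 0.
  by move=> n0; rewrite -size_poly_eq0 size1X.
have Wqd : (PA + PD)`_(q * d) != 0.
  by rewrite coefD PAE PDE Ar // subnn A0 -PoszD.
have sW : size (PA + PD) = (q * d).+1.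
  apply/eqP; rewrite eqn_leq; apply/andP; split; last first.
    by rewrite ltnNge; apply: contra Wqd => sW; rewrite nth_default.
  apply/leq_sizeP => j qj; rewrite coefD PAE PDE Aq // add0r.
  (* Beyond [q * d] the symmetry of [D] leads to indices below [k], where [D] vanishes. *)
  have [jk|jk] := ltnP (q * d + k) j; first by rewrite Dq.
  by rewrite Dr // Dk //; lia.
have W0 : PA + PD != 0 by rewrite -size_poly_eq0 sW.
have h0 : h != 0.
  apply: contraTneq W0 => h0; move: eq1; rewrite h0 mulr0 => /esym/eqP.
  by rewrite mulf_eq0 (negbTE (neq1X _ q0)) /= => ->.
have sh : (size h + k = q * d.+1 + 1)%N.
  have := congr1 (fun p : {poly int} => size p) eq1.
  by rewrite !size_mul ?neq1X // sW !size1X // mulnS addSn addSn addnS /= addn1 addnC.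
have sh0 : (0 < size h)%N by rewrite lt0n size_poly_eq0.
have lk : l = k.
  have e : ((size h).-1 + k = q * d.+1)%N by move: sh; rewrite -{1}(prednK sh0) addSn addn1 => -[].
  by rewrite /l -e addKn.
split=> //; rewrite lk; clear l lk.
pose S n : {poly int} := \sum_(i < n) 'X^i.
have SE n : 1 - 'X^n = (1 - 'X) * S n by rewrite -[LHS]opprB subrX1 -mulNr opprB.
have S0 n i : 0 <= (S n)`_i by rewrite coef_sum; apply: sumr_ge0 => j _; rewrite coefXn.
have SM n (p : {poly int}) : (forall i, 0 <= p`_i) -> forall i, 0 <= (S n * p)`_i.
  by move=> p0 i; rewrite coefM; apply: sumr_ge0 => j _; rewrite mulr_ge0.
have Sr : self_reciprocal q.-1%:Z (S q).
  have SqE i : (S q)`_i = (i < q)%N%:R.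
    have -> : S q = \poly_(i < q) 1 by rewrite poly_def; apply: eq_bigr => j _; rewrite scale1r.
    by rewrite coef_poly; case: ltnP.
  apply: palindromic_self_reciprocal.
    by apply/leq_sizeP => j qj; rewrite SqE ltnNge -(prednK q0) qj.
  by move=> i iq; rewrite !SqE; congr (nat_of_bool _)%:R; lia.
have PAr : self_reciprocal (q * d)%N%:Z PA.
  apply: palindromic_self_reciprocal; first exact: size_poly.
  by move=> i iq; rewrite !PAE Ar.
have PDr : self_reciprocal (q * d + k)%N%:Z PD.
  apply: palindromic_self_reciprocal; first exact: size_poly.
  by move=> i iq; rewrite !PDE Dr.
pose D' := drop_poly k PD.
have PDX : PD = 'X^k * D'.
  rewrite mulrC -[LHS](poly_take_drop k) (_ : take_poly k PD = 0) ?add0r //.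
  by apply/polyP => i; rewrite coef_take_poly coef0; case: ltnP => // ik; rewrite PDE Dk.
exists (S q * PA), (S q * D'); split.
- have X10 : (1 - 'X : {poly int}) != 0 by rewrite -['X]expr1 neq1X.
  have eqk : 1 - 'X^k = (1 - 'X) * \sum_(i < k) 'X^i :> {poly int} := SE k.
  apply: (mulfI X10); rewrite [LHS]mulrA -eqk eq1 SE -mulrA; congr (_ * _).
  by rewrite PDX; ring.
- have -> : (q * d.+1)%N%:Z - 1 = q.-1%:Z + (q * d)%N%:Z by rewrite mulnS; lia.
  exact: self_reciprocalM.
(* [PD] has exponent [q * d + k], and its quotient by ['X^k] has exponent [q * d - k]; the factor
   [S q] adds [q - 1]. *)
- have -> : (q * d.+1)%N%:Z - 1 - k%:Z = q.-1%:Z + ((q * d + k)%N%:Z - k%:Z - k%:Z).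
    by rewrite mulnS; lia.
  by apply: self_reciprocalM => //; apply: self_reciprocal_divX; rewrite -PDX.
- by apply: SM => i; rewrite PAE.
- by apply: SM => i; rewrite coef_drop_poly PDE.
Qed.

(** * Polytopes *)

Local Open Scope classical_set_scope.
Local Open Scope ring_scope.

Section Polytope.
Variables (R : realType) (d : nat).

Definition homog (x : 'rV[R]_d) : 'rV[R]_(d + 1) := row_mx x 1%:M.

Definition homog_mx n (f : 'I_n -> 'rV[R]_d) : 'M[R]_(n, d + 1) := \matrix_i homog (f i).

Lemma cone_homog n (f : 'I_n -> 'rV[R]_d) j : cone (homog_mx f) (homog (f j)).
Proof. by have := cone_row (homog_mx f) j; rewrite rowK. Qed.

Lemma homog_sum (I : finType) (c : I -> R) (f : I -> 'rV[R]_d) :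
  \sum_i c i = 1 -> homog (\sum_i c i *: f i) = \sum_i c i *: homog (f i).
Proof.
move=> c1; rewrite /homog (eq_bigr (fun i => row_mx (c i *: f i) (c i *: 1%:M))) => [|i _].
  rewrite -[1%:M in LHS](scale1r) -c1 scaler_suml.
  elim/big_rec3: _ => [|i a b e _ <-]; first by rewrite row_mx0.
  by rewrite add_row_mx.
by rewrite scale_row_mx.
Qed.

Lemma homog_inj : injective homog.
Proof. by move=> x y /eq_row_mx[]. Qed.

Lemma homog_mxE n (f : 'I_n -> 'rV[R]_d) (l : 'rV[R]_n) x : homog x = l *m homog_mx f ->
  \sum_i l 0 i = 1 /\ x = \sum_i l 0 i *: f i.
Proof.
rewrite mulmx_sum_row => e.
have e1 : \sum_i l 0 i = 1.
  have := congr1 (fun p : 'rV_(d + 1) => p 0 (rshift d ord0)) e.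
  rewrite row_mxEr mxE eqxx summxE => e1; apply: (etrans _ (esym e1)).
  apply: eq_bigr => i _.
  by rewrite mxE rowK row_mxEr mxE eqxx mulr1.
split=> //; apply: homog_inj; rewrite homog_sum // e; apply: eq_bigr => i _.
by rewrite rowK.
Qed.

(** The last homogeneous coordinate forces the coefficients of a conic combination to sum to [1]. *)
Lemma conv_hullP n (f : 'I_n -> 'rV[R]_d) x :
  conv_hull (range f) x <-> cone (homog_mx f) (homog x).
Proof.
split.
  case=> N [p [c [fp c0 c1 ->]]]; rewrite homog_sum //; apply: cone_sum => i _.
  by apply: coneZ => //; case: (fp i) => j _ <-; exact: cone_homog.
case=> l l0 /homog_mxE[l1 ->]; exists n, f, (fun i => l 0 i); split=> // i.
Qed.

Lemma dotvE u (x : 'rV[R]_d) : dotv u x = (x *m u^T) 0 0.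
Proof. by rewrite mxE; apply: eq_bigr => i _; rewrite mxE mulrC. Qed.

(** Among the generators the affine function given by [y] is negative only at [f i], so over the
    hull its minimum is attained at [f i] alone. *)
Lemma separated_is_vertex n (f : 'I_n -> 'rV[R]_d) i (y : 'cV[R]_(d + 1)) :
  (forall j, j != i -> 0 <= (homog (f j) *m y) 0 0) -> (homog (f i) *m y) 0 0 < 0 ->
  is_vertex (conv_hull (range f)) (f i).
Proof.
move=> yj yi; exists (- (usubmx y)^T).
pose val x := (homog x *m y) 0 0.
have dotE x : dotv (- (usubmx y)^T) x = (dsubmx y) 0 0 - val x.
  rewrite dotvE linearN /= trmxK mulmxN /val.
  have -> : homog x *m y = x *m usubmx y + dsubmx y.
    by rewrite -[in LHS](vsubmxK y) mul_row_col mul1mx.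
  by rewrite mxE [X in _ - X]mxE; ring.
have valP x : conv_hull (range f) x -> val (f i) <= val x ?= iff (x == f i).
  case/conv_hullP => l l0 e; have [l1 xE] := homog_mxE e.
  (* Both summands are nonnegative, and the first vanishes only if the weight of [f i] is [1]. *)
  have vE : val x - val (f i) = (1 - l 0 i) * (- val (f i)) +
      \sum_(j | j != i) l 0 j * val (f j).
    have -> : val x = \sum_j l 0 j * val (f j).
      rewrite /val e -mulmxA mxE; apply: eq_bigr => j _.
      by rewrite entry_mulmx_col rowK.
    by rewrite (bigD1 i) //=; ring.
  have li : l 0 i + \sum_(j | j != i) l 0 j = 1 by rewrite -l1 [RHS](bigD1 i).
  have s0 : 0 <= \sum_(j | j != i) l 0 j by apply: sumr_ge0.
  have t0 : 0 <= \sum_(j | j != i) l 0 j * val (f j).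
    by apply: sumr_ge0 => j ji; rewrite mulr_ge0 // yj.
  have t1 : 0 <= (1 - l 0 i) * (- val (f i)).
    by rewrite mulr_ge0 ?oppr_ge0 ?(ltW yi) // subr_ge0 -li lerDl.
  split; first by rewrite -subr_ge0 vE addr_ge0.
  apply/eqP/eqP => [ve|->//].
  have : (1 - l 0 i) * (- val (f i)) + \sum_(j | j != i) l 0 j * val (f j) == 0.
    by rewrite -vE ve subrr.
  rewrite paddr_eq0 // => /andP[+ _].
  rewrite mulf_eq0 oppr_eq0 (lt_eqF yi) orbF subr_eq0 => /eqP l_i.
  have : \sum_(j | j != i) l 0 j = 0 by apply: (addrI 1); rewrite {1}l_i li addr0.
  move/psumr_eq0P => H; rewrite xE (bigD1 i) //= -l_i scale1r big1 ?addr0 // => j ji.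
  by rewrite H ?scale0r.
have Pi : conv_hull (range f) (f i).
  by apply/conv_hullP; exact: cone_homog.
apply/seteqP; split=> x.
  case=> Px /(_ _ Pi); rewrite !dotE lerD2l lerN2 => vx.
  by apply/eqP; rewrite -(valP x Px).2 eq_le vx andbT (valP x Px).1.
by move=> ->; split=> // y' Py'; rewrite !dotE lerD2l lerN2 (valP _ Py').1.
Qed.

(** Each generator of nonzero weight in [w] also maximizes the functional exposing [w], hence equals
    [w]. *)
Lemma vertex_in_generators n (f : 'I_n -> 'rV[R]_d) w :
  is_vertex (conv_hull (range f)) w -> exists i, w = f i.
Proof.
case=> u fu; have [Pw maxw] : face (conv_hull (range f)) u w by rewrite fu.
have Pf j : conv_hull (range f) (f j).
  by apply/conv_hullP; exact: cone_homog.
case/conv_hullP: (Pw) => l l0 /homog_mxE[l1 wE].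
have dw : \sum_j l 0 j * (dotv u w - dotv u (f j)) = 0.
  under eq_bigr do rewrite mulrBr; rewrite sumrB -mulr_suml l1 mul1r {1}wE.
  apply/eqP; rewrite subr_eq0 dotvE mulmx_suml summxE; apply/eqP; apply: eq_bigr => j _.
  by rewrite -scalemxAl mxE dotvE.
have [j lj] : exists j, l 0 j != 0.
  apply/existsP; apply: contraT; rewrite negb_exists => /forallP lz.
  by have := oner_neq0 R; rewrite -l1 big1 ?eqxx // => j _; apply/eqP; rewrite -[_ == _]negbK lz.
exists j; move/psumr_eq0P: dw => /(_ _ j isT) H.
have /eqP : l 0 j * (dotv u w - dotv u (f j)) = 0.
  by apply: H => i _; rewrite mulr_ge0 // subr_ge0 maxw.
rewrite mulf_eq0 (negbTE lj) subr_eq0 => /eqP e.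
have : face (conv_hull (range f)) u (f j) by split=> // y Py; rewrite -e maxw.
by rewrite fu.
Qed.

(** In a generating family of minimal length no generator lies in the cone over the others, and the
    Farkas lemma separates it from them. *)
Lemma rational_polytope_vertices (P : set 'rV[R]_d) : rational_polytope P ->
  exists n (v : 'I_n -> 'rV[rat]_d),
    P = conv_hull (range (fun i => map_mx ratr (v i))) /\
    forall i, is_vertex P (map_mx ratr (v i)).
Proof.
case=> V PV.
have : exists n, `[< exists v : 'I_n -> 'rV[rat]_d,
    P = conv_hull (range (fun i => map_mx ratr (v i))) >].
  exists (size V); apply/asboolP; exists (tnth (in_tuple V)).
  rewrite PV; congr conv_hull; apply/seteqP; split=> w.
    case=> v /= vV <-; have /tnthP[i ->] : v \in in_tuple V by [].
    by exists i.
  by case=> i _ <-; exists (tnth (in_tuple V) i) => //=; exact: mem_tnth.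
case/ex_minnP => n /asboolP[v Pv] nmin; exists n, v; split=> // i.
case: n v Pv nmin i => [? ? ? []//|n] v Pv nmin i.
pose f j : 'rV[R]_d := map_mx ratr (v j).
pose f' j := f (lift i j).
have Ni : ~ cone (homog_mx f') (homog (f i)).
  move=> ci; have /nmin : `[< exists v' : 'I_n -> 'rV[rat]_d,
      P = conv_hull (range (fun i => map_mx ratr (v' i))) >].
    apply/asboolP; exists (fun j => v (lift i j)); rewrite Pv.
    apply/seteqP; split=> x; move/conv_hullP => cx; apply/conv_hullP;
      apply: sub_cone cx => j; rewrite rowK.
      have [->|] := eqVneq j i; first exact: ci.
      by case: (unliftP i j) => [j' -> _|->]; rewrite ?eqxx //; exact: (cone_homog f').
    exact: (cone_homog f).
  by rewrite ltnn.
have [y [yf yi]] := farkas Ni.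
rewrite Pv; apply: (@separated_is_vertex _ f i y) => // j ji.
case: (unliftP i j) ji => [j' -> _|->]; rewrite ?eqxx //.
by have := yf j'; rewrite entry_mulmx_col rowK.
Qed.

(** This ensures that [fset_set] in [denominator] really ranges over the vertices. *)
Lemma finite_rational_vertices (P : set 'rV[R]_d) : rational_polytope P ->
  finite_set [set v : 'rV[rat]_d | is_vertex P (map_mx ratr v)].
Proof.
case/rational_polytope_vertices => n [v [-> _]].
apply: (@sub_finite_set _ _ (v @` setT)); last by apply: finite_image; exact: finite_finset.
move=> w /vertex_in_generators[i wi]; exists i => //.
apply/rowP => j; move/rowP/(_ j): wi; rewrite !mxE => /eqP.
by rewrite (inj_eq (fmorph_inj _)) => /eqP.
Qed.

End Polytope.

Lemma dvdn_biglcm_seq (T : eqType) (s : seq T) (F : T -> nat) v :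
  v \in s -> (F v %| \big[lcmn/1]_(w <- s) F w)%N.
Proof. by move=> vs; rewrite (perm_big _ (perm_to_rem vs)) big_cons dvdn_lcml. Qed.

Lemma denominator_gt0 (R : realType) (d : nat) (P : set 'rV[R]_d) :
  (0 < denominator P)%N.
Proof.
rewrite /denominator; elim/big_ind: _ => // [a b a0 b0|v _]; first by rewrite lcmn_gt0 a0.
elim/big_ind: _ => // [a b a0 b0|i _]; first by rewrite lcmn_gt0 a0.
by rewrite absz_gt0 denq_neq0.
Qed.

Lemma denominator_integral (R : realType) (d : nat) (P : set 'rV[R]_d) v :
  rational_polytope P -> is_vertex P (map_mx ratr v) ->
  exists z : 'rV[int]_d, map_mx intr z = (denominator P)%:R *: map_mx ratr v :> 'rV[R]_d.
Proof.
move=> Prat vP; set q := denominator P.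
have vq i : (absz (denq (v 0%R i)) %| q)%N.
  have vs : v \in fset_set [set v : 'rV[rat]_d | is_vertex P (map_mx ratr v)].
    by rewrite in_fset_set ?inE //; exact: finite_rational_vertices.
  apply: dvdn_trans (dvdn_biglcm_seq _ vs).
  exact: (@dvdn_biglcm_seq _ _ (fun i : 'I_d => absz (denq (v 0 i)))) (mem_index_enum i).
(* Each numerator is multiplied by the cofactor of its denominator in [q]. *)
exists (\row_i (numq (v 0 i) * (q %/ absz (denq (v 0%R i)))%N%:Z)).
apply/rowP => i; rewrite !mxE /ratr.
have d0 : (denq (v 0 i))%:~R != 0 :> R by rewrite intr_eq0 denq_neq0.
apply: (mulIf d0); rewrite -[in RHS]mulrA divfK // -{2}(divnK (vq i)).
rewrite intrM natrM -!mulrA mulrC.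
by rewrite -!pmulrn natr_absz gtr0_norm ?denq_gt0 //; ring.
Qed.

(** * Dilates of the polytope as slices of the cone *)

Section DilateCone.
Variables (R : realType) (d n q : nat) (f : 'I_n -> 'rV[R]_d) (gz : 'I_n -> 'rV[int]_d).
Hypothesis q0 : (0 < q)%N.
Hypothesis gzf : forall i, map_mx intr (gz i) = q%:R *: f i :> 'rV[R]_d.
Let P := conv_hull (range f).
Hypothesis Pdim : full_dimensional P.
Local Notation pt := (@lattice_pt R d).
Local Notation G := (lattice_gens R gz (fun => q)).

Lemma lattice_gens_homog : G = q%:R *: homog_mx f.
Proof.
apply/row_matrixP => i; rewrite rowK linearZ /= rowK /lattice_pt /homog gzf.
by rewrite scale_row_mx scale_scalar_mx mulr1.
Qed.

Lemma cone_lattice_gens p : cone G p <-> cone (homog_mx f) p.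
Proof.
have q0R : q%:R != 0 :> R by rewrite pnatr_eq0 -lt0n.
rewrite lattice_gens_homog; split; apply: sub_cone => i.
  by rewrite linearZ /=; apply: coneZ; [exact: ler0n|exact: cone_row].
have -> : row i (homog_mx f) = q%:R^-1 *: row i (q%:R *: homog_mx f).
  by rewrite linearZ /= scalerA mulVf // scale1r.
by apply: coneZ; [rewrite invr_ge0 ler0n|exact: cone_row].
Qed.

Lemma row_full_lattice_gens : row_full G.
Proof.
have hs x : (homog x <= G)%MS.
  have : aff_hull P x by rewrite Pdim.
  case=> N [p [c [Pp c1 ->]]]; rewrite homog_sum //; apply: summx_sub => i _.
  apply: scalemx_sub; have /conv_hullP/cone_lattice_gens[l _ ->] := Pp i.
  exact: submxMl.
rewrite -sub1mx; apply/row_subP => i; set r := row i _.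
(* A vector with last coordinate [t] is a homogenized point plus [t - 1] times the homogenized
   origin. *)
have -> : r = homog (lsubmx r) + ((rsubmx r) 0 0 - 1) *: (homog 0).
  rewrite /homog scale_row_mx scaler0 add_row_mx addr0 scalerBl scale1r addrC subrK.
  by rewrite scalemx1 -mx11_scalar hsubmxK.
by apply: addmx_sub => //; apply: scalemx_sub.
Qed.

Lemma dilate_cone t z : dilate t P (map_mx intr z) <-> cone G (pt z t).
Proof.
split.
  case=> p /conv_hullP cp e; apply/cone_lattice_gens.
  have -> : pt z t = t%:R *: homog p.
    by rewrite /lattice_pt -e /homog scale_row_mx scale_scalar_mx mulr1.
  by apply: coneZ.
(* For [t = 0] both sides mean [z = 0], since [P] is nonempty: its affine hull is the whole
   space. *)
have [->|t0] := posnP t.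
  move/(cone_height0 q0) => ->.
  have : aff_hull P 0 by rewrite Pdim.
  case=> -[|N] [p [c [Pp c1 _]]]; first by move/eqP: c1; rewrite big_ord0 eq_sym oner_eq0.
  by exists (p ord0) => //; rewrite scale0r map_mx0.
have t0R : t%:R != 0 :> R by rewrite pnatr_eq0 -lt0n.
move=> /cone_lattice_gens cz; exists (t%:R^-1 *: map_mx intr z); last first.
  by rewrite scalerA mulfV // scale1r.
apply/conv_hullP; have -> : homog (t%:R^-1 *: map_mx intr z) = t%:R^-1 *: pt z t.
  by rewrite /homog /lattice_pt scale_row_mx scale_scalar_mx mulVf.
by apply: coneZ => //; rewrite invr_ge0.
Qed.

End DilateCone.

Theorem theorem4p7 (R : realType) (d : nat) (P : set 'rV[R]_d)
    (Prat : rational_polytope P) (Pdim : full_dimensional P)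
    (h : {poly int}) (hP : is_hstar P h) :
  let q := denominator P in
  let s := (size h).-1 in
  let l := (q * d.+1 - s)%N in
  let hbar := (\sum_(i < l) 'X^i) * h in
  let decomposition (a b : {poly int}) :=
    [/\ hbar = a + 'X^l * b,
        self_reciprocal ((q * d.+1)%:Z - 1) a
      & self_reciprocal ((q * d.+1)%:Z - 1 - l%:Z) b] in
  (exists! ab : {poly int} * {poly int}, decomposition ab.1 ab.2) /\
  (forall a b : {poly int}, decomposition a b ->
     (forall i : nat, 0 <= a`_i) /\ (forall i : nat, 0 <= b`_i)).
Proof.
move=> q s l hbar decomposition.
have q0 : (0 < q)%N := denominator_gt0 P.
have [n [v [Pv vP]]] := rational_polytope_vertices Prat.
have [gz gzv] := choice (fun i => denominator_integral Prat (vP i)).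
have Pdim' := Pdim; rewrite Pv in Pdim'.
have fullG := row_full_lattice_gens q0 gzv Pdim'.
have [k [A [D [k0 AD HA HD]]]] := ehrhart_box_decomposition q0 fullG.
have ehrE : (fun t => (ehr P t)%:Z) = fun t =>
    (cnt [set z | cone (lattice_gens R gz (fun => q)) (lattice_pt R z t)])%:Z.
  have DC := dilate_cone q0 gzv Pdim'; rewrite -Pv in DC.
  by apply/funext => t; congr (Posz #|` fset_set _|%fset); apply/seteqP; split=> z /= /DC.
have hE : (fun m => h`_m) = conv ((1 - 'X^q) ^+ d.+1) (fun t => (ehr P t)%:Z).
  by apply/funext => m; rewrite -hP.
(* Both sides are the product of [(1 - z^k) (1 - z^q)^(d+1)] with the Ehrhart series. *)
have hAD : conv (1 - 'X^k) (fun m => h`_m) = conv (1 - 'X^q) (fun m => (A m + D m)%N%:Z).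
  rewrite hE -AD -ehrE -conv_bdiff -conv_exp_bdiff -!convM.
  by rewrite exprS [_ * (1 - _)]mulrC.
have [lk [a [b [e ha hb a0 b0]]]] := hstar_decomposition q0 k0 hAD HA HD.
(* In particular the natural number subtraction in [l] does not truncate. *)
have l0 : (0 < l)%N by rewrite /l /s lk.
have uniq a' b' : decomposition a' b' -> a = a' /\ b = b'.
  case=> e' ha' hb'; apply: (decomposition_unique l0 _ ha hb ha' hb').
  by rewrite -e -e'.
split; last by move=> a' b' /uniq[<- <-].
by exists (a, b); split=> [|[a' b'] /= /uniq[-> ->]].
Qed.
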